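(* Let $n\ge1$. The set $\{\overline{\mathfrak{P}}_a\}$ of kaons, $a$ ranging over weak compositions of length $n$, is a basis of $\mathrm{Poly}_n[\beta]$ (over $\mathbb{Z}[\beta]$). The kaons deform the fundamental particles, in that specializing $\overline{\mathfrak{P}}_a$ at $\beta=0$ yields the fundamental particle $\mathfrak{P}_a$. The kaons are a common refinement of the glide polynomials and of the Lascoux atoms; that is, for every weak composition $a$ of length $n$, \[ \overline{\mathfrak{F}}_a=\sum_b P^a_b\,\overline{\mathfrak{P}}_b\qquad\text{and}\qquad \overline{\mathfrak{A}}_a=\sum_b Q^a_b\,\overline{\mathfrak{P}}_b, \] where the (finite) sums are over weak compositions $b$ of length $n$ and $P^a_b,Q^a_b\in\mathbb{Z}_{\ge0}[\beta]$ are polynomials in $\beta$ with nonnegative integer coefficients.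
   Context: Fix $n\ge1$; $\beta$ is a formal parameter. $\mathrm{Poly}_n=\mathbb{Z}[x_1,\dots,x_n]$. A weak composition of length $n$ is a sequence $a=(a_1,\dots,a_n)$ of nonnegative integers, and $\mathbf{x}^a=x_1^{a_1}\cdots x_n^{a_n}$. Glides and kaons. A weak komposition is a weak composition whose positive entries are each colored black or red (different colorings are different weak kompositions); its excess $\mathrm{ex}$ is the number of red entries. Let $a$ have nonzero entries exactly in positions $n_1<\dots<n_\ell$, and put $n_0=0$. A weak komposition $b$ of length $n$ is a glide of $a$ if there exist integers $0=i_0<i_1<\dots<i_\ell$ such that $b_k=0$ for $k>i_\ell$ and, for each $1\le j\le\ell$: $a_{n_j}=b_{i_{j-1}+1}+\dots+b_{i_j}-\mathrm{ex}(b_{i_{j-1}+1},\dots,b_{i_j})$; $i_j\le n_j$; and the leftmost nonzero entry among $b_{i_{j-1}+1},\dots,b_{i_j}$ is black. The glide polynomial is $\overline{\mathfrak{F}}_a=\sum_b\beta^{\mathrm{ex}(b)}\mathbf{x}^b$ over all glides $b$ of $a$. A weak komposition $b$ of length $n$ is a mesonic glide of $a$ if $b_k=0$ for $k>n_\ell$ and, for each $1\le j\le\ell$: $a_{n_j}=b_{n_{j-1}+1}+\dots+b_{n_j}-\mathrm{ex}(b_{n_{j-1}+1},\dots,b_{n_j})$; the leftmost nonzero entry among $b_{n_{j-1}+1},\dots,b_{n_j}$ is black; and $b_{n_j}\ne0$. The kaon is $\overline{\mathfrak{P}}_a=\sum_b\beta^{\mathrm{ex}(b)}\mathbf{x}^b$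 over all mesonic glides $b$ of $a$. Fundamental particles. $\mathfrak{P}_a=\sum_b\mathbf{x}^b$ over all weak compositions $b$ of length $n$ with $b_k=0$ for $k>n_\ell$ and, for each $1\le j\le \ell$, $a_{n_j}=b_{n_{j-1}+1}+\dots+b_{n_j}$ and $b_{n_j}\neq0$. Lascoux atoms. The skyline diagram $D(a)$ has $a_i$ left-justified boxes in row $i$; row $1$ is the lowest row. A triple consists of three boxes, two of them adjacent in a row (left box with entry $\beta'$, right box with entry $\alpha'$) and a third box with entry $\gamma'$, such that either (Type A) the third box is above the right box, in the same column as it, and the lower of the two rows is weakly longer, or (Type B) the third box is below the left box, in the same column as it, and the higher of the two rows is strictly longer. A triple is an inversion triple if $\gamma'<\alpha'\le\beta'$ or $\alpha'\le\beta'<\gamma'$. A set-valued filling assigns a nonempty set of positive integers to each box; the maximum of each box is its anchor, all other entries are free. It is semistandard if (S.1) entries do not repeat in a column; (S.2) rows are weakly decreasing from left to right, where $A\ge B$ means $\min A\ge\max B$; (S.3) every triple of anchors is an inversion triple; (S.4) each free entry is in the cell of the least anchor in its column such that (S.2) is not violated (i.e. among the cells of its column with larger anchor in which it could be placed without violating (S.2), it is in the one with least anchor); (S.5) anchors in the first column equal their row index. Let $\overline{\mathfrak{A}}\mathsf{SSF}(a)$ be the set of semistandard set-valued fillings of $D(a)$. For a filling $F$, $\mathrm{wt}(F)=(c_1,\dots,c_n)$ with $c_i$ the number of $i$'s in $F$, and $\mathrm{ex}(F)$ is the number of free entries. The Lascoux atom is $\overline{\mathfrak{A}}_a=\sum_{F\in\overline{\mathfrak{A}}\mathsf{SSF}(a)}\beta^{\mathrm{ex}(F)}\mathbf{x}^{\mathrm{wt}(F)}$.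 *)

(* Defs.v *)
From HB Require Import structures.
From mathcomp Require Import all_boot all_order all_algebra.
From mathcomp Require Import mpoly.

Set Implicit Arguments.
Unset Strict Implicit.
Unset Printing Implicit Defensive.

Import GRing.Theory Num.Theory.
Local Open Scope ring_scope.

(** Weak compositions of length n are the monomials ['X_{1..n}].  Positions,
    rows, columns and entries of fillings are 0-based throughout.  Poly_n[beta]
    is represented as the Z[beta]-module [{mpoly {poly int}[n]}], beta being
    ['X : {poly int}]. *)

Definition is_basis (R : nzRingType) (V : lmodType R) (I : choiceType)
    (v : I -> V) : Prop :=
  (forall (s : seq I) (c : I -> R), uniq s ->
     \sum_(i <- s) c i *: v i = 0 -> forall i, i \in s -> c i = 0)
  /\ (forall u : V, exists (s : seq I) (c : I -> R),
        uniq s /\ u = \sum_(i <- s) c i *: v i).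

Section Compositions.
Local Open Scope nat_scope.
Variable n : nat.
Implicit Types (a b : 'X_{1..n}) (R B : {set 'I_n}) (c : seq nat).

(* The nonzero positions n_1 < ... < n_l of a. *)
Definition nzpos a : seq 'I_n := [seq k <- enum 'I_n | a k != 0].

(* The 1-based list n_0 = 0, n_1, ..., n_l. *)
Definition nzcuts a : seq nat := 0 :: [seq k.+1 | k : 'I_n <- nzpos a].

(* For cuts c_0 < c_1 < ..., the positions which are c_j + 1, ..., c_{j+1} in
   1-based numbering. *)
Definition block c (j : nat) : {set 'I_n} :=
  [set k : 'I_n | nth 0 c j <= k < nth 0 c j.+1].

Definition blockwise a c (P : 'I_n -> {set 'I_n} -> bool) : bool :=
  [forall j : 'I_(size (nzpos a)),
     P (tnth (in_tuple (nzpos a)) j) (block c j)].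

Definition vanishes_after b (m : nat) : bool :=
  [forall k : 'I_n, (m <= k) ==> (b k == 0)].

(* A weak komposition is a pair (b, R), R being the set of the positions of
   the red entries; its excess is #|R|. *)
Definition komposition b R : bool := R \subset [set k | b k != 0].

Definition leftmost_black b R B : bool :=
  [exists k in B, [&& b k != 0, k \notin R
                    & [forall k' in B, (k' < k) ==> (b k' == 0)]]].

(* The block condition a_{n_j} = sum - excess is written additively, since
   subtraction on nat is truncated. *)
Definition kompose a b R c : bool :=
  [&& komposition b R, vanishes_after b (last 0 c)
    & blockwise a c (fun p B =>
        (a p + #|R :&: B| == \sum_(k in B) b k) && leftmost_black b R B)].

(* The integers i_1 < ... < i_l satisfy i_j <= n_j <= n, so they range over
   'I_n.+1 without loss. *)
Definition glide a b R : bool :=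
  [exists i : (size (nzpos a)).-tuple 'I_n.+1,
     let c := 0 :: [seq val x | x <- i] in
     [&& sorted ltn c, all2 leq c (nzcuts a) & kompose a b R c]].

Definition mesonic_glide a b R : bool :=
  kompose a b R (nzcuts a) && all (fun k => b k != 0) (nzpos a).

Definition particle_comp a b : bool :=
  [&& vanishes_after b (last 0 (nzcuts a)),
      blockwise a (nzcuts a) (fun p B => a p == \sum_(k in B) b k)
    & all (fun k => b k != 0) (nzpos a)].

End Compositions.

(** Every (mesonic) glide (b, R) of a satisfies mdeg b = mdeg a + #|R|, which
    is at most mdeg a + n, so bounding the degree of b discards nothing; for
    the fundamental particles, mdeg b = mdeg a. *)

Definition glide_poly n (a : 'X_{1..n}) : {mpoly {poly int}[n]} :=
  \sum_(b : 'X_{1..n < (mdeg a + n).+1}) \sum_(R : {set 'I_n} | glide a b R)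
     'X^#|R| *: 'X_[b].

Definition kaon n (a : 'X_{1..n}) : {mpoly {poly int}[n]} :=
  \sum_(b : 'X_{1..n < (mdeg a + n).+1})
     \sum_(R : {set 'I_n} | mesonic_glide a b R) 'X^#|R| *: 'X_[b].

Definition fundamental_particle n (a : 'X_{1..n}) : {mpoly int[n]} :=
  \sum_(b : 'X_{1..n < (mdeg a).+1} | particle_comp a b) 'X_[b].

Section LascouxAtoms.
Local Open Scope nat_scope.
Variables (n : nat) (a : 'X_{1..n}).

Definition box : finType := {i : 'I_n & 'I_(a i)}.
Definition brow (x : box) : 'I_n := tag x.
Definition bcol (x : box) : nat := tagged x.

(* In a semistandard filling all entries lie in {1, ..., n}, by (S.2) and
   (S.5), so only those are allowed; v : 'I_n encodes the entry v + 1, and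
   rows are shifted in the same way. *)
Definition filling := {ffun box -> {set 'I_n}}.
Implicit Types (F : filling) (x y z : box) (v : 'I_n).

Definition smax (A : {set 'I_n}) : nat := \max_(v in A) v.
Definition smin (A : {set 'I_n}) : nat := \big[minn/n]_(v in A) v.

Definition anchor F x : nat := smax (F x).
Definition free F x v : bool := (v \in F x) && (val v != anchor F x).

(* y is the box immediately to the right of x. *)
Definition right_of x y : bool := (brow x == brow y) && (bcol y == (bcol x).+1).

Definition set_valued F : bool := [forall x, F x != set0].

Definition S1 F : bool :=
  [forall x, forall y,
     (x != y) && (bcol x == bcol y) ==> [disjoint F x & F y]].

Definition S2 F : bool :=
  [forall x, forall y, right_of x y ==> (smax (F y) <= smin (F x))].

(* Triples: x is the left box, y the right box and z the third box. *)
Definition typeA x y z : bool :=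
  [&& right_of x y, bcol z == bcol y, brow y < brow z
    & a (brow z) <= a (brow y)].
Definition typeB x y z : bool :=
  [&& right_of x y, bcol z == bcol x, brow z < brow x
    & a (brow z) < a (brow x)].

Definition inversion (left right third : nat) : bool :=
  (third < right <= left) || (right <= left < third).

Definition S3 F : bool :=
  [forall x, forall y, forall z, typeA x y z || typeB x y z ==>
     inversion (anchor F x) (anchor F y) (anchor F z)].

(* The filling obtained from F by moving the entry v from box x to box y. *)
Definition move F v x y : filling :=
  [ffun z => if z == y then v |: F z else if z == x then F z :\ v else F z].

Definition S4 F : bool :=
  [forall x, forall v, free F x v ==>
     [forall y, [&& bcol y == bcol x, v < anchor F y & S2 (move F v x y)] ==>
        (anchor F x <= anchor F y)]].

Definition S5 F : bool :=
  [forall x, (bcol x == 0) ==> (anchor F x == brow x)].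

Definition semistandard F : bool :=
  [&& set_valued F, S1 F, S2 F, S3 F, S4 F & S5 F].

Definition wt F : 'X_{1..n} := [multinom #|[set x | i \in F x]| | i < n].
Definition excess F : nat := #|[set xv : box * 'I_n | free F xv.1 xv.2]|.

End LascouxAtoms.

Definition lascoux_atom n (a : 'X_{1..n}) : {mpoly {poly int}[n]} :=
  \sum_(F : filling a | semistandard F) 'X^(excess F) *: 'X_[wt F].

(* f is a finite sum of kaons with coefficients in Z_{>=0}[beta]. *)
Definition kaon_positive n (f : {mpoly {poly int}[n]}) : Prop :=
  exists (s : seq 'X_{1..n}) (Q : 'X_{1..n} -> {poly int}),
    [/\ uniq s, forall b, Q b \is a polyOver Num.nneg
      & f = \sum_(b <- s) Q b *: kaon b].

(* Main.v *)
Require Import Defs.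
From HB Require Import structures.
From mathcomp Require Import all_boot all_order all_algebra.
From mathcomp Require Import mpoly.
From mathcomp Require Import zify.
Import GRing.Theory Num.Theory.

Set Implicit Arguments.
Unset Strict Implicit.
Unset Printing Implicit Defensive.

(** The monomial x^a is the least term of the kaon of a, and mdeg b plus the
    number of zeros of b never increases along the terms x^b of a kaon; this
    unitriangularity over finite sets gives the basis property.

    A glide of a determines where its blocks end once each block is required to
    end at a nonzero entry, because trailing red 1s contribute nothing to a block
    while the next block starts with a black entry.  Hence the glide polynomial
    of a is the sum of the kaons of the compositions obtained from a by sliding
    its nonzero entries to the left.

    In a filling F, link an entry v to the next larger entry w that occurs in F
    if every w lies in a box strictly left of, or equal to, every box of a v.
    Replacing each entry by the end of its chain of links ([collapse]) preserves
    semistandardness in both directions: two entries that become equal are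
    already ordered by their columns.  In a fibre, the boxes of an entry m of the
    collapsed filling form a one-row set-valued tableau whose entries are the
    chain of m, and such tableaux are the blocks of a mesonic glide of its
    weight, an entry being red when it shares a box with a smaller entry of its
    chain.  So the Lascoux atom is the sum of beta^ex(T) times the kaon of wt(T),
    over the semistandard T that have no links. *)

(** * Mesonic glides *)

Section NextIn.
Variables (n : nat) (C : {set 'I_n}).
Implicit Types (v w m q : 'I_n).

Definition is_nextIn v m : bool :=
  [&& m \in C, v <= m & [forall q in C, (v <= q) ==> (m <= q)]].

(** The default [v] keeps the function inflationary and monotone on all of ['I_n], even past the
    last element of [C]. *)
Definition nextIn v : 'I_n := odflt v [pick m | is_nextIn v m].

Lemma nextIn_eq v m :
  m \in C -> v <= m -> (forall q, q \in C -> v <= q -> m <= q) -> nextIn v = m.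
Proof.
move=> mC vm min_m; rewrite /nextIn; case: pickP => [m' | /(_ m)] /=.
  case/and3P=> m'C vm' /forall_inP min_m'; apply/val_inj/eqP.
  by rewrite eqn_leq min_m //= andbT; apply: (implyP (min_m' _ mC)).
rewrite /is_nextIn mC vm /= => /forall_inP[] q qC.
by apply/implyP; apply: min_m.
Qed.

Lemma nextInP v q :
  q \in C -> v <= q -> [/\ nextIn v \in C, v <= nextIn v & nextIn v <= q].
Proof.
move=> qC vq; pose P m := (m \in C) && (v <= m).
have Pq : P q by rewrite /P qC.
case: (arg_minnP val Pq) => m /andP[mC vm] min_m.
rewrite (@nextIn_eq v m) //; first by split=> //; apply: min_m.
by move=> q' q'C vq'; apply: min_m; rewrite /P q'C.
Qed.

Lemma nextIn_id m : m \in C -> nextIn m = m.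
Proof. by move=> mC; apply: nextIn_eq. Qed.

Lemma le_nextIn v : v <= nextIn v.
Proof. by rewrite /nextIn; case: pickP => //= m /and3P[]. Qed.

Lemma nextIn_mono v w : v <= w -> nextIn v <= nextIn w.
Proof.
move=> vw; case: (boolP (nextIn w \in C)) => [cC | cNC].
  by have [] := nextInP cC (leq_trans vw (le_nextIn w)).
rewrite {1}/nextIn; case: pickP => [m | _] /=; last exact: leq_trans (le_nextIn w).
case/and3P=> mC _ _; rewrite leqNgt; apply: contra cNC => lt_w_m.
by have [] := nextInP mC (leq_trans (le_nextIn w) (ltnW lt_w_m)).
Qed.

End NextIn.

(** * Mesonic glides in terms of fibers of [nextIn] *)

Section Mesonic.
Variable n : nat.
Implicit Types (a b c : 'X_{1..n}) (R B : {set 'I_n}).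

Definition supp a : {set 'I_n} := [set k | a k != 0].

(* The j-th block of [a] is the fiber of [nextIn (supp a)] over [n_j]. *)
Definition fiber a (u : 'I_n) : {set 'I_n} := [set v | nextIn (supp a) v == u].

(** Mesonic glides without indices of blocks. The colour condition becomes: every red entry is
    preceded, in its block, by a black nonzero one. *)
Record mes a b R : Prop := Mes {
  mes_red : R \subset supp b;
  mes_last : forall k, k \in supp b -> exists2 m, m \in supp a & k <= m;
  mes_supp : supp a \subset supp b;
  mes_sum : forall u, u \in supp a ->
    a u + #|R :&: fiber a u| = \sum_(k in fiber a u) b k;
  mes_black : forall v, v \in R -> exists v' : 'I_n,
    [/\ v' < v, v' \in supp b, v' \notin R & nextIn (supp a) v' = nextIn (supp a) v]
}.

Lemma mem_nzpos a k : (k \in nzpos a) = (a k != 0).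
Proof. by rewrite mem_filter mem_enum andbT. Qed.

Lemma sorted_nzpos a : sorted ltn (map val (nzpos a)).
Proof.
rewrite sorted_map; apply: sorted_filter => [x y z /=|]; first exact: ltn_trans.
by rewrite -sorted_map val_enum_ord iota_ltn_sorted.
Qed.

Lemma nth_nzpos a x0 i j : i < size (nzpos a) -> j < size (nzpos a) ->
  (nth x0 (nzpos a) i < nth x0 (nzpos a) j) = (i < j).
Proof.
move=> lti ltj; have Hlt := sorted_ltn_nth ltn_trans 0 (sorted_nzpos a).
have lt k l : k < size (nzpos a) -> l < size (nzpos a) -> k < l ->
    nth x0 (nzpos a) k < nth x0 (nzpos a) l.
  move=> ltk ltl; have := Hlt k l; rewrite !inE size_map => /(_ ltk ltl) /[apply].
  by rewrite !(nth_map x0).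
case: (ltngtP i j) => [ij | ji | ->]; last exact: ltnn.
  exact: lt.
by apply/negbTE; rewrite -leqNgt ltnW // lt.
Qed.

Lemma block_nzcuts a (j : 'I_(size (nzpos a))) :
  block n (nzcuts a) j = fiber a (tnth (in_tuple (nzpos a)) j).
Proof.
have x0 : 'I_n by exact: tnth (in_tuple (nzpos a)) j.
rewrite (tnth_nth x0) /=; set p := nth x0 _.
have pS i : i < size (nzpos a) -> p i \in supp a.
  by move=> lti; rewrite inE -mem_nzpos mem_nth.
have cS i : i < size (nzpos a) -> nth 0 (nzcuts a) i.+1 = (p i).+1.
  by move=> lti; rewrite /= (nth_map x0).
apply/setP=> k; rewrite !inE cS // ltnS; apply/andP/eqP => [[ck kp] | ck].
  apply: nextIn_eq; rewrite ?pS // => q; rewrite inE -mem_nzpos => /(nthP x0)[i lti <-] kq.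
  rewrite leqNgt nth_nzpos //; apply/negP=> ij.
  (* The first block has lower cut 0; any other begins just after the previous nonzero position of
     [a]. *)
  move: ck; case ej: (j : nat) ij => [|j'] //; rewrite ltnS => ij.
  have ltj' : j' < size (nzpos a) by rewrite (ltn_trans _ (ltn_ord j)) ?ej.
  rewrite cS // ltnNge (leq_trans kq) //.
  by rewrite leqNgt nth_nzpos // -leqNgt.
rewrite -ck le_nextIn; split=> //; rewrite leqNgt; apply/negP.
case ej: (j : nat) => [|j'] //.
have ltj' : j' < size (nzpos a) by rewrite (ltn_trans _ (ltn_ord j)) ?ej.
rewrite cS // ltnS => kp'.
have [_ _] := nextInP (pS _ ltj') kp'.
by rewrite ck leqNgt nth_nzpos // ej ltnSn.
Qed.

Lemma last_nzcutsP a (k : 'I_n) :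
  reflect (exists2 m, m \in supp a & k <= m) (k < last 0 (nzcuts a)).
Proof.
have sz : 0 < size (nzpos a) ->
    last 0 (nzcuts a) = (nth k (nzpos a) (size (nzpos a)).-1).+1.
  rewrite /= => sz; rewrite (last_nth 0) size_map -[in LHS](prednK sz) /=.
  by rewrite (nth_map k) // prednK.
case: (posnP (size (nzpos a))) => [/size0nil e0 | pos].
  rewrite /nzcuts e0 /=; right=> -[m]; rewrite inE -mem_nzpos e0 //.
rewrite sz // ltnS; apply: (iffP idP) => [le_k | [m]].
  exists (nth k (nzpos a) (size (nzpos a)).-1) => //.
  by rewrite inE -mem_nzpos mem_nth // prednK.
rewrite inE -mem_nzpos => /(nthP k)[i lti <-] /leq_trans; apply.
by rewrite leqNgt nth_nzpos ?prednK // -ltnNge.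
Qed.

(** A leftmost nonzero entry that is black precedes all red ones; conversely a red one cannot be
    leftmost if some black nonzero entry precedes it. *)
Lemma leftmost_blackP b R B : R \subset supp b ->
  reflect ((exists2 k, k \in B & k \in supp b) /\
    forall v, v \in R :&: B -> exists v' : 'I_n,
      [/\ v' < v, v' \in supp b, v' \notin R & v' \in B])
  (leftmost_black b R B).
Proof.
move=> Rb; apply: (iffP existsP) => [[k /and4P[kB bk kR /forall_inP first_k]]|].
  split=> [|v]; first by exists k; rewrite ?inE.
  rewrite inE => /andP[vR vB]; exists k; rewrite kB kR inE; split=> //.
  rewrite ltn_neqAle (contraNneq _ kR) /=; last by move=> /val_inj ->.
  rewrite leqNgt; apply/negP => vk; have /implyP/(_ vk) := first_k _ vB.
  by move: (subsetP Rb _ vR); rewrite inE => /negbTE ->.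
case=> [[k kB kb] black].
pose P m := (m \in B) && (m \in supp b).
have Pk : P k by rewrite /P kB.
case: (arg_minnP val Pk) => m /andP[mB mb] min_m.
exists m; rewrite mB /=; move: (mb); rewrite inE => -> /=; apply/andP; split.
  apply/negP=> mR; have [|v' [lt_v' v'b _ v'B]] := black m; first by rewrite inE mR.
  by have := min_m v'; rewrite /P v'B v'b leqNgt lt_v' => /(_ isT).
apply/forall_inP=> k' k'B; apply/implyP; apply: contraTT => bk'.
by rewrite -leqNgt; apply: min_m; rewrite /P k'B inE.
Qed.

Lemma mesonicP a b R : reflect (mes a b R) (mesonic_glide a b R).
Proof.
apply: (iffP idP).
  case/andP=> /and3P[Rb /forallP van /forallP bw] /allP top.
  have Rb' : R \subset supp b by [].
  have bw' u : u \in supp a -> (a u + #|R :&: fiber a u| == \sum_(k in fiber a u) b k)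
      && leftmost_black b R (fiber a u).
    rewrite inE -mem_nzpos => /(nthP u)[j ltj uj].
    by have := bw (Ordinal ltj); rewrite block_nzcuts (tnth_nth u) /= uj.
  have last_b k : k \in supp b -> exists2 m, m \in supp a & k <= m.
    rewrite inE => bk; apply/last_nzcutsP; rewrite ltnNge.
    by apply: contra bk; apply/implyP.
  split=> //.
  - by apply/subsetP=> k; rewrite !inE -mem_nzpos => /top.
  - by move=> u /bw' /andP[/eqP].
  move=> v vR; have [m ma vm] := last_b v (subsetP Rb' _ vR).
  have [ca _ _] := nextInP ma vm.
  have /andP[_ /(leftmost_blackP _ Rb')[_]] := bw' _ ca.
  case/(_ v); first by rewrite !inE vR eqxx.
  by move=> v' [? ? ?]; rewrite inE => /eqP ?; exists v'.
case=> Rb last_b ab sums black.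
apply/andP; split; last by apply/allP=> k; rewrite mem_nzpos => ak;
  have := subsetP ab k; rewrite !inE; apply.
apply/and3P; split=> //.
  apply/forallP=> k; apply/implyP; rewrite leqNgt; apply: contraNT => bk.
  by apply/last_nzcutsP/last_b; rewrite inE.
apply/forallP=> j; rewrite block_nzcuts; set u := tnth _ _.
have ua : u \in supp a by rewrite inE -mem_nzpos mem_tnth.
rewrite sums // eqxx /=; apply/(leftmost_blackP _ Rb); split.
  by exists u; [rewrite inE nextIn_id | apply: (subsetP ab)].
move=> v; rewrite !inE => /andP[vR /eqP vu].
by have [v' [? ? ? e]] := black v vR; exists v'; split=> //; rewrite inE e vu.
Qed.

End Mesonic.

(** * Block sums, degrees and triangularity *)

Section MesonicSums.
Variable n : nat.
Implicit Types (a b c : 'X_{1..n}) (R B : {set 'I_n}).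

(** What position [k] contributes to its block sum after the excess is removed. Red entries are
    nonzero, so the subtraction is exact; see [contentK]. *)
Definition content b R (k : 'I_n) : nat := b k - (k \in R).

Lemma contentK b R k : R \subset supp b -> content b R k + (k \in R) = b k.
Proof.
move=> /subsetP/(_ k); rewrite /content inE.
case: (k \in R) => [/(_ isT) | _]; lia.
Qed.

Lemma sum_content b R (P : pred 'I_n) : R \subset supp b ->
  \sum_(k | P k) content b R k + #|[set k in R | P k]| = \sum_(k | P k) b k.
Proof.
move=> Rb; rewrite -sum1dep_card [X in _ + X]big_mkcondl -big_split.
apply: eq_bigr => k _ /=.
by rewrite -(contentK k Rb); case: (k \in R).
Qed.

Lemma fiber_content a b R u : mes a b R -> u \in supp a ->
  \sum_(k in fiber a u) content b R k = a u.
Proof.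
move=> M ua; apply/eqP; rewrite -(eqn_add2r #|R :&: fiber a u|) (mes_sum M ua).
rewrite -(sum_content _ (mes_red M)) eqn_add2l; apply/eqP.
by congr #|pred_of_set _|; apply/setP=> k; rewrite !inE.
Qed.

(** The hypothesis makes [P] a union of whole blocks up to the last one, so the block equations can
    be added up. *)
Lemma mes_content a b R (P : pred 'I_n) : mes a b R ->
    (forall k m : 'I_n, m \in supp a -> k <= m ->
       P k = P (nextIn (supp a) k)) ->
  \sum_(k | P k) content b R k = \sum_(k | P k) a k.
Proof.
move=> M PC; pose C := supp a.
have -> : \sum_(k | P k) a k = \sum_(k | P k && (k \in C)) a k.
  rewrite [RHS]big_mkcondr; apply: eq_bigr => k _.
  by rewrite inE; case: (a k =P 0) => [->|].
have -> : \sum_(k | P k) content b R k =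
          \sum_(k | P k && (nextIn C k \in C)) content b R k.
  rewrite [RHS]big_mkcondr; apply: eq_bigr => k _.
  (* Beyond the last nonzero position of [a] the entries of [b] vanish. *)
  case: ifPn => // cN; apply/eqP; rewrite -leqn0 -(_ : b k = 0) ?leq_subr //.
  apply/eqP; apply: contraNT cN => bk; have [|m mC km] := mes_last M (k := k).
    by rewrite inE.
  by have [] := nextInP mC km.
rewrite (partition_big (nextIn C) (fun k => P k && (k \in C))) /=; last first.
  move=> k /andP[Pk cC]; rewrite cC andbT.
  by rewrite -(PC k _ cC) ?le_nextIn.
apply: eq_bigr => u /andP[Pu uC]; rewrite -(fiber_content M uC).
apply: eq_bigl => k; rewrite [RHS]inE -/C; apply/andP/eqP => [[_ /eqP] // | e].
have ku : k <= u by rewrite -e le_nextIn.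
by rewrite e uC (PC k u uC ku) -/C e Pu eqxx.
Qed.

Definition psum b R (m : nat) : nat := \sum_(k < n | k < m) content b R k.

Lemma psumS b R (k : 'I_n) : psum b R k.+1 = psum b R k + content b R k.
Proof.
rewrite /psum (bigD1 k) //= addnC; congr (_ + _); apply: eq_bigl => i.
by rewrite ltnS ltn_neqAle andbC.
Qed.

Lemma leq_psum b R l m : l <= m -> psum b R l <= psum b R m.
Proof.
move=> lm; rewrite /psum [leqLHS]big_mkcond [leqRHS]big_mkcond.
by apply: leq_sum => k _; case: ifP => // /leq_trans ->.
Qed.

(** The positions up to [u] form a union of blocks, because [u] ends one. *)
Lemma mes_psum a b R u : mes a b R -> u \in supp a ->
  psum b R u.+1 = \sum_(k < n | k <= u) a k.
Proof.
move=> M ua; rewrite /psum (eq_bigl (fun k : 'I_n => k <= u)) //.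
apply: (mes_content M) => k m ma km; apply/idP/idP; last exact/leq_trans/le_nextIn.
by move=> ku; have [] := nextInP ua ku.
Qed.

Lemma mes_mdeg a b R : mes a b R -> mdeg b = mdeg a + #|R|.
Proof.
move=> M; rewrite !mdegE -(mes_content (P := xpredT) M) //.
rewrite -(sum_content xpredT (mes_red M)); congr (_ + #|pred_of_set _|).
by apply/setP=> k; rewrite inE andbT.
Qed.

Lemma mes_refl a : mes a a set0.
Proof.
split=> //; first exact: sub0set; last by move=> v; rewrite inE.
  by move=> k ka; exists k.
move=> u ua; rewrite set0I cards0 addn0 (bigD1 u) /=; last by rewrite inE nextIn_id.
rewrite big1 ?addn0 // => k /andP[]; rewrite inE => /eqP e; apply: contraNeq => ak.
by rewrite -e nextIn_id // inE.
Qed.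

(* Monomials are compared by degree first, then lexicographically. *)
Lemma mes_le a b R : mes a b R -> (a <= b)%O.
Proof.
move=> M; have /eqP := mes_mdeg M.
case: (posnP #|R|) => [R0 | Rgt0 /eqP e]; last first.
  by apply/Order.POrderTheory.ltW/lt_mdeg_ltmc; rewrite e; lia.
rewrite R0 addn0 eq_sym => /eqP e.
have {R0} R0 : R = set0 by apply/eqP; rewrite -cards_eq0 R0.
subst R; rewrite Order.POrderTheory.le_eqVlt; case: eqP => //= ne.
have [k0 Pk0] : exists k0, a k0 != b k0.
  by apply/existsP; apply: contra_notT ne => /existsPn h; apply/mnmP=> k;
     apply/eqP; have := h k; rewrite negbK.
case: (@arg_minnP _ k0 (fun k => a k != b k) val Pk0) => k Pk min_k.
have eq_lt (i : 'I_n) : i < k -> a i = b i.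
  by move=> ik; apply/eqP; apply: contraLR ik => /min_k; rewrite -leqNgt.
apply/ltmcP => //; exists k => //.
(* At the first difference [k], a nonzero [a k] would end a block; the partial sums through [k]
   would then agree and force [a k = b k]. *)
case: (posnP (a k)) Pk => [-> | ak Pk]; first by rewrite lt0n eq_sym.
have := mes_psum M (u := k); rewrite inE -lt0n => /(_ ak).
have sum0 m : content b set0 m = b m by rewrite /content inE subn0.
rewrite psumS sum0 /psum [X in _ = X](bigD1 k) //= addnC.
rewrite (eq_bigr a) => [|i ik]; last by rewrite sum0 eq_lt.
rewrite (eq_bigl (fun i : 'I_n => (i <= k) && (i != k))); last first.
  by move=> i; rewrite ltn_neqAle andbC.
by move/addIn => e'; rewrite e' eqxx in Pk.
Qed.

Lemma mes_eq a R : mes a a R -> R = set0.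
Proof. by move/mes_mdeg/eqP; rewrite -{1}[mdeg a]addn0 eqn_add2l eq_sym cards_eq0 => /eqP. Qed.

Definition zeros a : nat := #|~: supp a|.

(** Each red entry adds 1 to the degree. Each block also keeps a black nonzero entry, so at least
    [#|R|] zeros of [a] are filled. *)
Lemma mes_zeros a b R : mes a b R -> mdeg b + zeros b <= mdeg a + zeros a.
Proof.
move=> M; rewrite (mes_mdeg M) -addnA leq_add2l.
have le_ab : #|supp a| <= #|supp b :\: R|.
  apply: leq_trans (leq_imset_card (nextIn (supp a)) _); apply: subset_leq_card.
  apply/subsetP=> u ua; have ub := subsetP (mes_supp M) u ua.
  case: (boolP (u \in R)) => [uR | uR].
    have [v [_ vb vR e]] := mes_black M uR.
    by apply/imsetP; exists v; rewrite ?in_setD ?vR // e nextIn_id.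
  by apply/imsetP; exists u; rewrite ?nextIn_id // in_setD uR.
have := cardsC (supp a); have := cardsC (supp b); have := cardsID R (supp b).
rewrite (setIidPr (mes_red M)) /zeros; lia.
Qed.

End MesonicSums.

(** * Linear combinations over lists *)

Section Spans.
Local Open Scope ring_scope.
Variables (R : nzRingType) (V : lmodType R) (I : choiceType) (v : I -> V).

Lemma collect_sum (J : eqType) (r : seq J) (P : pred J) (w : J -> R) (c : J -> I) :
  \sum_(j <- r | P j) w j *: v (c j) =
  \sum_(i <- undup [seq c j | j <- r])
     (\sum_(j <- r | P j && (c j == i)) w j) *: v i.
Proof.
under [RHS]eq_bigr do rewrite scaler_suml big_mkcondr.
rewrite (exchange_big_dep P) /=; last by [].
rewrite [LHS]big_seq_cond [RHS]big_seq_cond /=.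
apply: eq_bigr => j /andP[jr Pj]; rewrite Pj.
rewrite (bigD1_seq (c j)) ?undup_uniq ?mem_undup ?map_f //= eqxx big1 ?addr0 //.
by move=> i /negbTE; rewrite eq_sym => ->.
Qed.

(** Repeated generators are allowed, which makes closure under sums immediate; [collect_sum] merges
    them into the duplicate-free form of [is_basis]. *)
Definition spanned (u : V) : Prop :=
  exists r : seq (R * I), u = \sum_(p <- r) p.1 *: v p.2.

Lemma spanned0 : spanned 0.
Proof. by exists [::]; rewrite big_nil. Qed.

Lemma spannedD u1 u2 : spanned u1 -> spanned u2 -> spanned (u1 + u2).
Proof. by move=> [r1 ->] [r2 ->]; exists (r1 ++ r2); rewrite big_cat. Qed.

Lemma spannedZ a u : spanned u -> spanned (a *: u).
Proof.
move=> [r ->]; exists [seq (a * p.1, p.2) | p <- r].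
by rewrite big_map scaler_sumr; apply: eq_bigr => p _; rewrite scalerA.
Qed.

Lemma spanned_gen i : spanned (v i).
Proof. by exists [:: (1, i)]; rewrite big_seq1 scale1r. Qed.

Lemma spanned_sum (J : Type) (r : seq J) (P : pred J) (F : J -> V) :
  (forall j, P j -> spanned (F j)) -> spanned (\sum_(j <- r | P j) F j).
Proof. by apply: big_ind; [exact: spanned0 | exact: spannedD]. Qed.

End Spans.

(** * The basis property and the specialization at 0 *)

Section KaonCoefficients.
Local Open Scope ring_scope.
Variable n : nat.
Implicit Types (a b m : 'X_{1..n}).

(** Removes the degree bound from the sums that define kaons and glide polynomials. *)
Lemma mcoeff_scaled_monomials N (E : 'X_{1..n} -> {poly int}) m :
  (forall b, (N <= mdeg b)%N -> E b = 0) ->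
  (\sum_(b : 'X_{1..n < N}) E b *: 'X_[b])@_m = E m.
Proof.
move=> E0; case: (ltnP (mdeg m) N) => [mN | Nm].
  by rewrite (mcoeff_mpoly E).
rewrite E0 // linear_sum big1 //= => b _; rewrite mcoeffZ mcoeffX.
by case: eqP => [e|]; rewrite ?mulr0 //; have := bmdeg b; rewrite e ltnNge Nm.
Qed.

Lemma mcoeff_kaon a m :
  (kaon a)@_m = \sum_(R : {set 'I_n} | mesonic_glide a m R) 'X^#|R|.
Proof.
rewrite /kaon; under eq_bigr do rewrite -scaler_suml.
rewrite (mcoeff_scaled_monomials
  (E := fun b => \sum_(R : {set 'I_n} | mesonic_glide a b R) 'X^#|R|)) // => b.
rewrite ltnNge => lt_b; rewrite big_pred0 // => R; apply/mesonicP => /mes_mdeg e.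
by case/negP: lt_b; rewrite e leq_add2l -[leqRHS]card_ord max_card.
Qed.

Lemma mcoeff_kaon_neq0 a m : (kaon a)@_m != 0 -> exists R, mes a m R.
Proof.
rewrite mcoeff_kaon; case: (pickP (mesonic_glide a m)) => [R /mesonicP M _ | none].
  by exists R.
by rewrite big_pred0 ?eqxx.
Qed.

Lemma mcoeff_kaon_diag a : (kaon a)@_a = 1.
Proof.
rewrite mcoeff_kaon (big_pred1 set0) ?cards0 ?expr0 // => R.
apply/mesonicP/eqP => [/mes_eq // | ->]; exact: mes_refl.
Qed.

(** Well-founded induction on the monomial order: the coefficient at [i] involves only [c j] with
    [j <= i], and those with [j < i] already vanish. *)
Lemma kaon_lindep (s : seq 'X_{1..n}) (c : 'X_{1..n} -> {poly int}) : uniq s ->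
  \sum_(i <- s) c i *: kaon i = 0 -> forall i, i \in s -> c i = 0.
Proof.
move=> us s0; apply: ltmwf => i IH iS.
have := congr1 (mcoeff i) s0; rewrite mcoeff0 linear_sum /= (bigD1_seq i) //=.
rewrite mcoeffZ mcoeff_kaon_diag mulr1 big_seq_cond big1 ?addr0 // => j /andP[jS ne].
rewrite mcoeffZ; have [-> | /mcoeff_kaon_neq0[R /mes_le le_ji]] := eqVneq ((kaon j)@_i) 0.
  by rewrite mulr0.
by rewrite IH ?mul0r // Order.POrderTheory.lt_neqAle ne.
Qed.

(* The terms [b] of [kaon a] other than [a] are larger than [a] while
   [mdeg b + zeros b <= mdeg a + zeros a], so they range over a finite set. *)
Lemma spanned_monomial a : spanned (@kaon n) 'X_[a].
Proof.
(* [K] is fixed before the induction, so that the finite set in which [above] counts stays the same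
   for all later monomials. *)
move: {2}(_ + _)%N (leqnn (mdeg a + zeros a)) => K.
pose above b := [set i : 'X_{1..n < K.+1} | (b < i)%O].
have [k] := ubnP #|above a|; elim: k a => // k IH a; rewrite ltnS => ak aK.
have -> : 'X_[a] = kaon a + (- 1) *: (kaon a - 'X_[a]).
  by rewrite scaleN1r opprB addrC subrK.
apply: spannedD; first exact: spanned_gen.
apply: spannedZ; rewrite [_ - _]mpolyE big_seq_cond; apply: spanned_sum => b.
rewrite andbT mcoeff_msupp mcoeffB mcoeffX.
have [-> | ab] := eqVneq a b; first by rewrite mcoeff_kaon_diag subrr eqxx.
rewrite subr0 => /mcoeff_kaon_neq0[R M]; apply: spannedZ.
have lt_ab : (a < b)%O by rewrite Order.POrderTheory.lt_neqAle ab (mes_le M).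
have bK : (mdeg b + zeros b <= K)%N := leq_trans (mes_zeros M) aK.
have bK' : (mdeg b < K.+1)%N by rewrite ltnS (leq_trans _ bK) ?leq_addr.
apply: IH => //; apply: leq_trans ak; apply: proper_card; apply/properP; split.
  by apply/subsetP=> i; rewrite !inE; apply: Order.POrderTheory.lt_trans.
by exists (BMultinom bK'); rewrite inE //= Order.POrderTheory.ltxx.
Qed.

Lemma kaon_spanning (u : {mpoly {poly int}[n]}) : spanned (@kaon n) u.
Proof.
rewrite [u]mpolyE; apply: spanned_sum => m _; exact/spannedZ/spanned_monomial.
Qed.

Lemma kaon_basis : is_basis (@kaon n).
Proof.
split=> [s c | u]; first exact: kaon_lindep.
have [r ->] := kaon_spanning u.
exists (undup [seq p.2 | p <- r]), (fun i => \sum_(p <- r | p.2 == i) p.1).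
by rewrite collect_sum undup_uniq.
Qed.

(** Without red entries the colour condition only asks that each block be nonzero, and its last
    position already is. *)
Lemma mesonic_set0 a b : mesonic_glide a b set0 = particle_comp a b.
Proof.
rewrite /mesonic_glide /kompose /particle_comp /komposition sub0set /= -andbA.
congr (_ && _); rewrite andbC [RHS]andbC; case: allP => //= top.
apply: eq_forallb => j; rewrite set0I cards0 addn0 [X in _ && X](_ : _ = true) ?andbT //.
apply/leftmost_blackP; first exact: sub0set.
split=> [|v]; last by rewrite set0I inE.
exists (tnth (in_tuple (nzpos a)) j); last by rewrite inE top ?mem_tnth.
by rewrite block_nzcuts inE nextIn_id // inE -mem_nzpos mem_tnth.
Qed.

Lemma mcoeff_particle a m :
  (fundamental_particle a)@_m = (particle_comp a m)%:R.
Proof.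
rewrite /fundamental_particle big_mkcond /=.
under eq_bigr do rewrite -mulrb -scaler_nat.
case: (ltnP (mdeg m) (mdeg a).+1) => [lt_m | ge_m].
  by rewrite (mcoeff_mpoly (fun m => (particle_comp a m)%:R)).
rewrite raddf_sum big1 /= => [|b _]; last first.
  rewrite mcoeffZ mcoeffX; case: eqP => [e | _]; last by rewrite mulr0.
  by have := bmdeg b; rewrite e ltnNge ge_m.
rewrite -mesonic_set0; case: mesonicP => // /mes_mdeg e.
by move: ge_m; rewrite e cards0 addn0 ltnn.
Qed.

(** Evaluation at 0 kills every positive power of beta, which leaves the colouring without red
    entries. *)
Lemma kaon_at0 a :
  map_mpoly (horner_eval (0 : int)) (kaon a) = fundamental_particle a.
Proof.
apply/mpolyP=> m; rewrite mcoeff_map_mpoly mcoeff_kaon raddf_sum /=.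
rewrite mcoeff_particle -mesonic_set0 big_mkcond (bigD1 set0) //=.
rewrite big1 ?addr0 => [|R]; last first.
  rewrite -card_gt0 => R0; case: ifP => // _.
  by rewrite /horner_eval hornerXn expr0n eqn0Ngt R0.
by rewrite /horner_eval cards0 expr0 hornerC; case: ifP.
Qed.

End KaonCoefficients.

(** * Glide polynomials *)

Section Glides.
Variable n : nat.
Implicit Types (a b c : 'X_{1..n}) (R B : {set 'I_n}).

Definition flat a : seq nat := [seq a k | k : 'I_n <- nzpos a].

(** These compositions index the kaons in the glide polynomial of [a]. *)
Definition left_shift a c : bool :=
  (flat c == flat a) && all2 leq (nzcuts c) (nzcuts a).

Lemma size_flat a : size (flat a) = size (nzpos a).
Proof. exact: size_map. Qed.

Lemma mdeg_flat a : mdeg a = sumn (flat a).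
Proof.
rewrite mdegE sumnE big_map big_filter big_enum_cond /= [RHS]big_mkcond.
by apply: eq_bigr => k _; case: eqP.
Qed.

Lemma flat_inj a c : nzpos a = nzpos c -> flat a = flat c -> a = c.
Proof.
move=> enz /eqP; rewrite /flat -enz => /eqP/eq_in_map e; apply/mnmP=> k.
case: (boolP (k \in nzpos a)) => [/e // | ka]; move: (ka); rewrite enz.
by move: ka; rewrite !mem_nzpos !negbK => /eqP-> /eqP->.
Qed.

(** Only the values of the nonzero entries of [a] matter here; the positions enter through the cuts
    alone. *)
Lemma kompose_flat a c b R cuts : flat a = flat c ->
  kompose a b R cuts = kompose c b R cuts.
Proof.
move=> e; have sz : size (nzpos a) = size (nzpos c) by rewrite -!size_flat e.
rewrite /kompose; congr [&& _, _ & _]; rewrite /blockwise.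
have nthE d (j : 'I_(size (nzpos d))) :
    d (tnth (in_tuple (nzpos d)) j) = nth 0 (flat d) j.
  have x0 := tnth (in_tuple (nzpos d)) j.
  by rewrite (tnth_nth x0) /flat (nth_map x0).
apply/forallP/forallP => h j.
  by have := h (cast_ord (esym sz) j); rewrite !nthE e.
by have := h (cast_ord sz j); rewrite !nthE e.
Qed.

Lemma sorted_nzcuts a : sorted ltn (nzcuts a).
Proof.
rewrite /nzcuts; have := sorted_nzpos a; case: (nzpos a) => //= k s.
by rewrite !path_map.
Qed.

Lemma glide_left_shift a b R c : left_shift a c -> mes c b R -> glide a b R.
Proof.
case/andP=> /eqP e le_ca /mesonicP/andP[K _].
(* [lift ord0 k] has value [k.+1], the 1-based cut; the block ends of [c] witness the glide. *)
have sz : size [seq lift ord0 k | k <- nzpos c] == size (nzpos a).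
  by rewrite size_map -!size_flat e.
have ecuts : 0 :: [seq val x | x <- Tuple sz] = nzcuts c.
  by rewrite /nzcuts /= -map_comp.
apply/existsP; exists (Tuple sz); rewrite ecuts; apply/and3P.
by rewrite sorted_nzcuts le_ca (kompose_flat _ _ _ (esym e)).
Qed.

(** Shows that the partial sum through the [j]-th nonzero position depends on [flat a] only, hence
    is shared by all left shifts. *)
Lemma sum_le_nzpos a x0 j : j < size (nzpos a) ->
  \sum_(k < n | k <= nth x0 (nzpos a) j) a k =
  \sum_(0 <= i < size (flat a) | i <= j) nth 0 (flat a) i.
Proof.
move=> ltj; rewrite size_flat.
transitivity (\sum_(k <- nzpos a | k <= nth x0 (nzpos a) j) a k).
  rewrite big_filter_cond big_enum_cond /= [RHS]big_mkcondl [RHS]big_mkcond /=.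
  rewrite [LHS]big_mkcond; apply: eq_bigr => k _.
  by case: ifP; case: (a k =P 0).
rewrite (big_nth x0) [LHS]big_nat_cond [RHS]big_nat_cond.
apply: eq_big => [i | i /andP[/andP[_ lti] _]]; last first.
  by rewrite /flat (nth_map x0).
case: ltnP => //= lti; by rewrite leqNgt nth_nzpos // -leqNgt.
Qed.

(** If the [j]-th blocks ended at [p < p'], no content could lie between. Then [p'] is a red 1, and
    the black entry required before it in its block gives positive content after [p]. *)
Lemma left_shift_inj a b R c c' : left_shift a c -> left_shift a c' ->
  mes c b R -> mes c' b R -> c = c'.
Proof.
move=> /andP[/eqP ec _] /andP[/eqP ec' _] M M'.
suff no_lt d d' x0 j : flat d = flat a -> flat d' = flat a -> mes d b R ->
    mes d' b R -> j < size (flat a) ->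
    nth x0 (nzpos d) j < nth x0 (nzpos d') j -> False.
  have sz : size (nzpos c) = size (flat a) by rewrite -ec size_flat.
  have sz' : size (nzpos c') = size (flat a) by rewrite -ec' size_flat.
  apply: flat_inj; last by rewrite ec.
  case e: (nzpos c) => [|x0 s].
    by apply/esym/size0nil; rewrite sz' -sz e.
  rewrite -e; apply: (@eq_from_nth _ x0) => [|j ltj]; first by rewrite sz.
  have {}ltj : j < size (flat a) by rewrite -sz.
  apply: ord_inj.
  case: (ltngtP (nth x0 (nzpos c) j) (nth x0 (nzpos c') j)) => // lt.
    by have [] := no_lt _ _ _ _ ec ec' M M' ltj lt.
  by have [] := no_lt _ _ _ _ ec' ec M' M ltj lt.
move=> ed ed' {c c' ec ec' M M'} M M' ltj lt_pp'.
have szd : size (nzpos d) = size (flat a) by rewrite -ed size_flat.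
have szd' : size (nzpos d') = size (flat a) by rewrite -ed' size_flat.
set p := nth x0 (nzpos d) j in lt_pp'; set p' := nth x0 _ j in lt_pp'.
have pd : p \in supp d by rewrite inE -mem_nzpos mem_nth ?szd.
have pd' : p' \in supp d' by rewrite inE -mem_nzpos mem_nth ?szd'.
have eqS : psum b R p'.+1 = psum b R p.+1.
  by rewrite (mes_psum M pd) (mes_psum M' pd') !sum_le_nzpos ?szd ?szd' // ed ed'.
have bp' : b p' != 0 by have := subsetP (mes_supp M') _ pd'; rewrite inE.
have le1 := leq_psum b R lt_pp'.
have pR : p' \in R.
  by move: eqS le1; rewrite psumS /content; case: (p' \in R) bp' => //; lia.
have [v [lt_v vb vR e]] := mes_black M pR.
(* [p] ends a block of [d], so the block of [d] through [p'] starts after [p]. *)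
have lt_pv : p < v.
  rewrite ltnNge; apply/negP => le_vp; have [_ _] := nextInP pd le_vp.
  by rewrite e leqNgt (leq_trans lt_pp') // le_nextIn.
have le2 := leq_psum b R lt_v; have le3 := leq_psum b R lt_pv.
have bv : b v != 0 by rewrite inE in vb.
have := psumS b R v; have := psumS b R p'.
by rewrite /content (negbTE vR); lia.
Qed.

Lemma all2_leqP (s1 s2 : seq nat) :
  reflect (size s1 = size s2 /\ forall i, i < size s1 -> nth 0 s1 i <= nth 0 s2 i)
          (all2 leq s1 s2).
Proof.
rewrite all2E; apply: (iffP andP) => [[/eqP e /(all_nthP (0, 0)) h] | [e h]]; split=> //.
  by move=> i lti; have := h i; rewrite size_zip -e minnn nth_zip //; apply.
  exact/eqP.
by apply/(all_nthP (0, 0)) => i; rewrite size_zip -e minnn nth_zip //=; apply: h.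
Qed.

(** Zero entries affect neither sums nor colours, so a block may gain or lose them. *)
Lemma eq_block_supp b R B B' : R \subset supp b ->
    {in supp b, B =i B'} ->
  [/\ R :&: B = R :&: B', \sum_(k in B) b k = \sum_(k in B') b k
    & leftmost_black b R B = leftmost_black b R B'].
Proof.
move=> Rb eqB; have RB : R :&: B = R :&: B'.
  apply/setP=> k; rewrite !inE; case: (boolP (k \in R)) => //= kR.
  by rewrite eqB // (subsetP Rb).
split=> //.
  rewrite big_mkcond [RHS]big_mkcond; apply: eq_bigr => k _.
  case: (posnP (b k)) => [->|]; rewrite ?if_same // lt0n => bk.
  by rewrite eqB // inE.
apply/(leftmost_blackP _ Rb)/(leftmost_blackP _ Rb) => -[[k kB kb] black].
  split; first by exists k; rewrite -?eqB.
  rewrite -RB => v /black[v' [? v'b ? ?]]; exists v'.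
  by rewrite -eqB.
split; first by exists k; rewrite ?eqB.
rewrite RB => v /black[v' [? v'b ? ?]]; exists v'.
by rewrite eqB.
Qed.

(* Shrink every block of the glide so that it ends at a nonzero entry. *)
Lemma glide_exists_left_shift a b R : glide a b R ->
  exists2 c, left_shift a c & mes c b R.
Proof.
case/existsP=> t; cbv zeta; set d := 0 :: _ => /and3P[sort_d le_d K].
set l := size (nzpos a) in t d sort_d le_d K *.
have szd : size d = l.+1 by rewrite /= size_map size_tuple.
have dlt i j : i < j -> j <= l -> nth 0 d i < nth 0 d j.
  move=> ij jl; have := sorted_ltn_nth ltn_trans 0 sort_d.
  by apply=> //; rewrite inE szd ltnS // ltnW // (leq_trans ij).
have dle i j : i <= j -> j <= l -> nth 0 d i <= nth 0 d j.
  by rewrite leq_eqVlt => /predU1P[-> // | ij] jl; apply/ltnW/dlt.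
have /and3P[Rb _ /forallP bw] := K.
(* [s j] is the last nonzero position of [b] in the [j]-th block; it becomes the new block end,
   where [c] puts the [j]-th nonzero entry of [a]. *)
have /fin_all_exists[s sP] (j : 'I_l) : exists k : 'I_n, [/\ k \in block n d j,
    k \in supp b & forall k', k' \in block n d j -> k' \in supp b -> k' <= k].
  have /andP[_ /(leftmost_blackP _ Rb)[[k0 k0B k0b] _]] := bw j.
  pose P k := (k \in block n d j) && (k \in supp b).
  case: (@arg_maxnP _ k0 P val); first by rewrite /P k0B.
  move=> k /andP[kB kb] max_k; exists k; split=> // k' k'B k'b.
  by apply: max_k; rewrite /P k'B.
have s_lo (j : 'I_l) : nth 0 d j <= s j by have [] := sP j; rewrite inE => /andP[].
have s_hi (j : 'I_l) : s j < nth 0 d j.+1 by have [] := sP j; rewrite inE => /andP[].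
have s_mono (i j : 'I_l) : i < j -> s i < s j.
  by move=> ij; rewrite (leq_trans (s_hi i)) // (leq_trans _ (s_lo j)) // dle // ltnW.
have s_inj : injective s.
  move=> i j e; apply: ord_inj.
  by case: (ltngtP i j) => // /s_mono; rewrite e ltnn.
pose p j := tnth (in_tuple (nzpos a)) j.
pose c := [multinom if [pick j | s j == k] is Some j then a (p j) else 0 | k < n].
have cs j : c (s j) = a (p j).
  rewrite mnmE; case: pickP => [j' /eqP/s_inj -> // | /(_ j)].
  by rewrite eqxx.
have ap j : a (p j) != 0 by rewrite -mem_nzpos mem_tnth.
have enz : nzpos c = codom s.
  have tr : transitive (relpre (val : 'I_n -> nat) ltn).
    by move=> x y z /=; apply: ltn_trans.
  apply: (irr_sorted_eq tr) => [x /=| | |k]; first exact: ltnn.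
  - by rewrite -sorted_map sorted_nzpos.
  - rewrite sorted_map; apply: (@sub_sorted _ (relpre val ltn)) => //.
    by rewrite -sorted_map val_enum_ord iota_ltn_sorted.
  rewrite mem_nzpos; apply/idP/codomP => [|[j ->]]; last by rewrite cs.
  by rewrite mnmE; case: pickP => [j /eqP <- _|//]; exists j.
have szc : size (nzpos c) = l by rewrite enz size_codom card_ord.
have ef : flat c = flat a.
  rewrite /flat enz -map_comp (eq_map (g := (fun k => a k) \o p)) => [|j]; last exact: cs.
  by rewrite map_comp map_tnth_enum.
have ccut (j : 'I_l) : nth 0 (nzcuts c) j.+1 = (s j).+1.
  rewrite /= (nth_map (s j)) ?szc // enz (nth_map j) ?size_enum_ord //.
  by rewrite nth_ord_enum.
(* Moving the cuts back to the [s j] shifts only zeros of [b] from one block to the next. *)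
have block_eq (j : 'I_l) : {in supp b, block n (nzcuts c) j =i block n d j}.
  move=> k kb; rewrite 2!in_set ccut ltnS; apply/andP/andP => -[lo hi].
    split; last exact: leq_ltn_trans (s_hi j).
    rewrite leqNgt; apply/negP; case ej: (j : nat) lo => [|j'] // + lt_k.
    have ltj' : j' < l by rewrite -ltnS -ej ltnS ltnW.
    have /= -> := ccut (Ordinal ltj') => lt_sk.
    have [_ _ /(_ k)] := sP (Ordinal ltj').
    rewrite in_set lt_k andbT (leq_trans (s_lo (Ordinal ltj'))) ?(ltnW lt_sk) //.
    by move=> /(_ isT kb); rewrite leqNgt lt_sk.
  split; last by have [_ _] := sP j; apply=> //; rewrite in_set lo.
  case ej: (j : nat) lo => [|j'] // lo.
  have ltj' : j' < l by rewrite -ltnS -ej ltnS ltnW.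
  by have /= -> := ccut (Ordinal ltj'); apply: leq_trans lo; apply: s_hi.
have lastE x : size x = l.+1 -> last 0 x = nth 0 x l.
  by move=> szx; rewrite -nth_last szx.
have sz_c : size (nzcuts c) = l.+1 by rewrite /= size_map szc.
exists c.
  rewrite /left_shift ef eqxx andTb; apply/all2_leqP; rewrite sz_c.
  split=> [|[|j] // ltj]; first by rewrite /= size_map.
  rewrite ltnS in ltj; rewrite (ccut (Ordinal ltj)).
  have /all2_leqP[_ /(_ j.+1)] := le_d; rewrite szd ltnS => /(_ ltj).
  exact/leq_trans/(s_hi (Ordinal ltj)).
apply/mesonicP/andP; split; last first.
  apply/allP=> k; rewrite enz => /codomP[j ->].
  by have [_] := sP j; rewrite inE.
rewrite -(kompose_flat _ _ _ (esym ef)); apply/and3P; split=> //.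
  have /and3P[_ /forallP van _] := K.
  apply/forallP=> k; have := van k; rewrite !lastE //.
  case: (leqP (nth 0 d l) k) => [_ /= -> | lt_k _]; first by rewrite implybT.
  apply/implyP => le_k.
  apply/negPn/negP => bk; have kb : k \in supp b by rewrite inE.
  (* A nonzero entry after the last [s j] but before the last old cut would contradict the
     maximality of [s j]. *)
  have [j ej] : exists j : 'I_l, j.+1 = l.
    case: (posnP l) => [l0 | l_gt0]; first by move: lt_k; rewrite l0.
    have lt_l : l.-1 < l by rewrite prednK.
    by exists (Ordinal lt_l); rewrite /= prednK.
  move: le_k lt_k; rewrite -ej (ccut j) => lt_sk lt_k.
  have [_ _ /(_ k)] := sP j; rewrite in_set lt_k andbT.
  by rewrite (leq_trans (s_lo j) (ltnW lt_sk)) leqNgt lt_sk => /(_ isT kb).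
apply/forallP=> j; have := bw j.
by have [-> -> ->] := eq_block_supp Rb (block_eq j).
Qed.

Lemma glideP a b R :
  reflect (exists2 c, left_shift a c & mes c b R) (glide a b R).
Proof.
apply: (iffP idP) => [/glide_exists_left_shift // | [c]].
exact: glide_left_shift.
Qed.

Lemma left_shift_mdeg a c : left_shift a c -> mdeg c = mdeg a.
Proof. by case/andP=> /eqP e _; rewrite !mdeg_flat e. Qed.

Local Open Scope ring_scope.

Lemma mcoeff_glide a m :
  (glide_poly a)@_m = \sum_(R : {set 'I_n} | glide a m R) 'X^#|R|.
Proof.
rewrite /glide_poly; under eq_bigr do rewrite -scaler_suml.
rewrite (mcoeff_scaled_monomials
  (E := fun b => \sum_(R : {set 'I_n} | glide a b R) 'X^#|R|)) // => b.
rewrite ltnNge => lt_b; rewrite big_pred0 // => R.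
apply/glideP => -[c /left_shift_mdeg ec /mes_mdeg e].
by case/negP: lt_b; rewrite e ec leq_add2l -[leqRHS]card_ord max_card.
Qed.

(** Every glide is a mesonic glide of exactly one left shift. Left shifts preserve the degree, hence
    the bound on the index. *)
Lemma glide_sum_kaons a :
  glide_poly a = \sum_(c : 'X_{1..n < (mdeg a).+1} | left_shift a c) kaon c.
Proof.
apply/mpolyP=> m; rewrite mcoeff_glide raddf_sum /=.
under [RHS]eq_bigr do rewrite mcoeff_kaon.
rewrite (exchange_big_dep xpredT) //= big_mkcond; apply: eq_bigr => R _.
case: glideP => [[c ac M] | none]; last first.
  by rewrite big_pred0 // => c; apply/andP => -[ac /mesonicP M]; apply: none; exists c.
have lt_c : (mdeg c < (mdeg a).+1)%N by rewrite ltnS (left_shift_mdeg ac).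
rewrite (big_pred1 (BMultinom lt_c)) // => c'.
apply/andP/eqP => [[ac' /mesonicP M'] | ->]; last by split=> //; apply/mesonicP.
by apply: val_inj; apply: left_shift_inj ac' ac M' M.
Qed.

Lemma kaon_positive_sum (J : finType) (P : pred J) (e : J -> nat) (c : J -> 'X_{1..n}) :
  kaon_positive (\sum_(j | P j) 'X^(e j) *: kaon (c j)).
Proof.
exists (undup [seq c j | j <- index_enum J]).
exists (fun b => \sum_(j | P j && (c j == b)) 'X^(e j)); split.
- exact: undup_uniq.
- move=> b /=; apply/polyOverP=> i; rewrite coef_sum nnegrE.
  by apply: sumr_ge0 => j _; rewrite coefXn ler0n.
- exact: collect_sum.
Qed.

Lemma glide_kaon_positive a : kaon_positive (glide_poly a).
Proof.
rewrite glide_sum_kaons; under eq_bigr do rewrite -[kaon _]scale1r -(expr0 'X).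
exact: kaon_positive_sum.
Qed.

End Glides.

(** * Lascoux atoms *)

Section Fillings.
Variables (n : nat) (a : 'X_{1..n}).
Implicit Types (F : filling a) (x y z : box a) (v w u : 'I_n).

Lemma smax_leP (A : {set 'I_n}) m :
  reflect (forall v, v \in A -> v <= m) (smax A <= m).
Proof. exact: bigmax_leqP. Qed.

Lemma smax_le_sminP (A B : {set 'I_n}) :
  reflect (forall v w, v \in A -> w \in B -> v <= w) (smax A <= smin B).
Proof.
apply: (iffP idP) => [le_AB v w vA wB | le_AB].
  have /smax_leP/(_ _ vA)/leq_trans := leqnn (smax A); apply.
  apply: leq_trans le_AB _.
  rewrite /smin; elim: (index_enum _) (mem_index_enum w) => // i s IH.
  rewrite inE big_cons => /predU1P[<- | /IH le]; first by rewrite wB geq_minl.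
  by case: ifP => _ //; rewrite geq_min le orbT.
apply/smax_leP=> v vA; rewrite /smin.
by elim/big_ind: _ => [|m1 m2 h1 h2|w wB]; rewrite ?leq_min ?h1 ?h2 ?le_AB // ltnW.
Qed.

(** Unlike the number [anchor F x], this names the anchor as an entry, to which [nextIn] can be
    applied. *)
Definition is_anchor F x v : Prop := v \in F x /\ forall w, w \in F x -> w <= v.

Lemma anchorE F x v : is_anchor F x v -> anchor F x = v.
Proof.
case=> vF max_v; apply/eqP; rewrite eqn_leq; apply/andP; split.
  exact/smax_leP.
by have /smax_leP/(_ _ vF) := leqnn (smax (F x)).
Qed.

Lemma anchor_exists F x : set_valued F -> exists v, is_anchor F x v.
Proof.
move/forallP/(_ x)/set0Pn=> [v0 v0F].
case: (@arg_maxnP _ v0 (mem (F x)) val v0F) => v vF max_v.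
by exists v.
Qed.

Lemma S1P F : reflect
  (forall x y v, bcol x = bcol y -> v \in F x -> v \in F y -> x = y) (S1 F).
Proof.
apply: (iffP forallP) => [h x y v exy vx vy | h x].
  apply/eqP; apply: contraTT vy => xy; have /forallP/(_ y) := h x.
  by rewrite xy exy eqxx /= => dis; rewrite (disjointFr dis vx).
apply/forallP=> y; apply/implyP=> /andP[xy /eqP exy].
rewrite -setI_eq0; apply: contraNT xy => /set0Pn[v /setIP[vx vy]].
by apply/eqP/(h x y v).
Qed.

Lemma S2P F : reflect
  (forall x y v w, right_of x y -> v \in F y -> w \in F x -> v <= w) (S2 F).
Proof.
apply: (iffP forallP) => [h x y v w xy | h x].
  by move: v w; apply/smax_le_sminP; have /forallP/(_ y)/implyP := h x; apply.
by apply/forallP=> y; apply/implyP=> xy; apply/smax_le_sminP=> v w; apply: h.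
Qed.

Lemma right_of_col x y : right_of x y -> bcol y = (bcol x).+1.
Proof. by case/andP=> _ /eqP. Qed.

Definition fits F v y : Prop :=
  (forall z w, right_of z y -> w \in F z -> v <= w) /\
  (forall z w, right_of y z -> w \in F z -> w <= v).

(** Removing [v] from [x] breaks nothing, and [x] is not a neighbour of [y], being in its column;
    only the neighbours of [y] constrain the move. *)
Lemma move_S2P F v x y : S2 F -> x != y -> bcol x = bcol y ->
  reflect (fits F v y) (S2 (move F v x y)).
Proof.
move=> /S2P F2 xy exy.
have mv z w : w \in move F v x y z -> w \in F z \/ (z = y /\ w = v).
  rewrite ffunE; case: (z =P y) => [->|_].
    by case/setU1P=> [->|]; [right | left].
  by case: ifP => [/eqP->|]; [case/setD1P|]; left.
have mvE z : z <> x -> z <> y -> move F v x y z = F z.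
  by move=> /eqP/negbTE zx /eqP/negbTE zy; rewrite ffunE zx zy.
apply: (iffP (S2P _)) => [h | [fl fr] z1 z2 w1 w2 z12].
  have vy : v \in move F v x y y by rewrite ffunE eqxx setU11.
  split=> z w r wz.
    apply: (h _ _ _ _ r) => //; rewrite mvE // => e.
      by have := right_of_col r; rewrite e exy; lia.
    by have := right_of_col r; rewrite e; lia.
  apply: (h _ _ _ _ r) => //; rewrite mvE // => e.
    by have := right_of_col r; rewrite e exy; lia.
  by have := right_of_col r; rewrite e; lia.
case/mv=> [w1F | [e1 ->]] /mv[w2F | [e2 ->]].
- exact: F2 z12 w1F w2F.
- by rewrite e2 in z12; apply: fr z12 w1F.
- by rewrite e1 in z12; apply: fl z12 w2F.
by [].
Qed.

(** By (S.2) the right anchor is at most the left one, so an inversion triple is one whose third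
    anchor avoids the closed interval between them. *)
Lemma S3P F : set_valued F -> S2 F -> reflect
  (forall x y z v w u, typeA x y z || typeB x y z -> is_anchor F x w ->
     is_anchor F y v -> is_anchor F z u -> ~~ (v <= u <= w)) (S3 F).
Proof.
move=> F0 /S2P F2.
have invE x y z v w u : typeA x y z || typeB x y z -> is_anchor F x w ->
    is_anchor F y v -> is_anchor F z u ->
    inversion (anchor F x) (anchor F y) (anchor F z) = ~~ (v <= u <= w).
  move=> xyz Ax Ay Az; rewrite (anchorE Ax) (anchorE Ay) (anchorE Az) /inversion.
  have r : right_of x y by case/orP: xyz => /andP[].
  have := F2 _ _ _ _ r Ay.1 Ax.1; lia.
apply: (iffP forallP) => [h x y z v w u xyz Ax Ay Az | h x].
  rewrite -(invE x y z) //.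
  by have /forallP/(_ y)/forallP/(_ z)/implyP := h x; apply.
apply/forallP=> y; apply/forallP=> z; apply/implyP=> xyz.
have [w Ax] := anchor_exists x F0; have [v Ay] := anchor_exists y F0.
have [u Az] := anchor_exists z F0.
by rewrite (invE x y z v w u) //; apply: h Ax Ay Az.
Qed.

Lemma S4P F : set_valued F -> S2 F -> reflect
  (forall x y v w u, bcol x = bcol y -> x != y -> v \in F x -> v < w ->
     is_anchor F x w -> is_anchor F y u -> v < u -> fits F v y -> w <= u) (S4 F).
Proof.
move=> F0 F2; apply: (iffP forallP) => [h x y v w u exy xy vx vw Ax Ay vu fit | h x].
  have /forallP/(_ v)/implyP := h x; rewrite /Defs.free vx (anchorE Ax) neq_ltn vw.
  move=> /(_ isT)/forallP/(_ y)/implyP; rewrite (anchorE Ay); apply.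
  by rewrite exy eqxx vu; apply/move_S2P.
apply/forallP=> v; apply/implyP=> /andP[vx v_free].
apply/forallP=> y; apply/implyP=> /and3P[/eqP eyx + S2m].
have [w Ax] := anchor_exists x F0; have [u Ay] := anchor_exists y F0.
rewrite (anchorE Ax) (anchorE Ay) in v_free *; move=> vu.
have [e | xy] := eqVneq x y; first by rewrite -(anchorE Ax) -(anchorE Ay) e.
apply: (h x y v w u) => //; last by apply/move_S2P: S2m.
by rewrite ltn_neqAle v_free /= Ax.2.
Qed.

End Fillings.

(** * Collapsing chains of entries *)

Section Collapse.
Variables (n : nat) (a : 'X_{1..n}).
Implicit Types (F T : filling a) (x y z : box a) (u v w : 'I_n) (C : {set 'I_n}).

Definition right_or_eq x y : Prop := bcol y < bcol x \/ x = y.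

Lemma right_or_eq_trans y x z : right_or_eq x y -> right_or_eq y z -> right_or_eq x z.
Proof. by move=> [xy | ->] // [yz | <-]; left=> //; apply: ltn_trans xy. Qed.

Definition collapse C F : filling a := [ffun x => nextIn C @: F x].

Definition present F : {set 'I_n} := [set v | [exists x, v \in F x]].

Lemma presentP F v : reflect (exists x, v \in F x) (v \in present F).
Proof. by rewrite inE; apply: existsP. Qed.

(** [C] is the set of chain ends. Stated for general [C] in order to cover both [tops F] and, for a
    split filling, the entries of the filling that was split. *)
Record mergeable C F : Prop := Mergeable {
  mergeable_sub : C \subset present F;
  mergeable_next : forall v, v \in present F -> exists2 m, m \in C & v <= m;
  mergeable_left : forall x y v w, v \in F x -> w \in F y -> v < w ->
    nextIn C v = nextIn C w -> right_or_eq x y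
}.

Lemma mem_collapse C F x v : v \in F x -> nextIn C v \in collapse C F x.
Proof. by move=> vx; rewrite ffunE imset_f. Qed.

Lemma collapseP C F x u :
  reflect (exists2 v, v \in F x & u = nextIn C v) (u \in collapse C F x).
Proof. by rewrite ffunE; apply: imsetP. Qed.

Section Semistandard.
Variables (C : {set 'I_n}) (F : filling a).
Hypothesis CF : mergeable C F.
Local Notation g := (nextIn C).
Local Notation T := (collapse C F).

Lemma nextIn_present v : v \in present F -> g v \in C.
Proof. by case/(mergeable_next CF) => m mC vm; have [] := nextInP mC vm. Qed.

(** If [w < v] had the same chain end, then [y] would be strictly right of [x] or equal to it. The
    transfers of (S.1) to (S.4) pull comparisons back through this. *)
Lemma collapse_le_reflect x y v w : v \in F x -> w \in F y ->
  bcol y <= bcol x -> x != y -> g v <= g w -> v <= w.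
Proof.
move=> vx wy yx ne gvw; rewrite leqNgt; apply/negP => wv.
have e : g w = g v by apply/val_inj/eqP; rewrite eqn_leq gvw nextIn_mono // ltnW.
have [|exy] := mergeable_left CF wy vx wv e; first by rewrite ltnNge yx.
by rewrite exy eqxx in ne.
Qed.

Lemma collapse_set_valued : set_valued T = set_valued F.
Proof.
apply: eq_forallb => x; rewrite ffunE.
by rewrite -!card_gt0 !card_gt0 imset_eq0.
Qed.

Lemma collapse_anchor x v : is_anchor F x v -> is_anchor T x (g v).
Proof.
case=> vx max_v; split; first exact: mem_collapse.
by move=> _ /collapseP[w wx ->]; apply/nextIn_mono/max_v.
Qed.

Lemma collapse_anchor_inv x u : set_valued F -> is_anchor T x u ->
  exists2 v, is_anchor F x v & u = g v.
Proof.
move=> F0 Tu; have [v Fv] := anchor_exists x F0; exists v => //.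
by apply/val_inj; rewrite /= -(anchorE Tu) (anchorE (collapse_anchor Fv)).
Qed.

Lemma collapse_S1 : S1 T = S1 F.
Proof.
apply/S1P/S1P => h x y v exy.
  by move=> vx vy; apply: (h x y (g v)) => //; apply: mem_collapse.
case/collapseP=> w1 w1x -> /collapseP[w2 w2y e].
apply/eqP; apply/negPn/negP => ne.
have e12 : w1 = w2.
  apply/val_inj/eqP; rewrite eqn_leq (collapse_le_reflect w1x w2y) ?exy ?e //.
  by rewrite (collapse_le_reflect w2y w1x) ?exy ?e // eq_sym.
by move: ne; rewrite (h x y w1) ?eqxx // e12.
Qed.

Lemma collapse_S2 : S2 T = S2 F.
Proof.
apply/S2P/S2P => h x y v w r.
  move=> vy wx; have c := right_of_col r.
  apply: (collapse_le_reflect vy wx); first by rewrite c.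
    by apply/eqP=> e; move: c; rewrite e; lia.
  by apply: h r _ _; apply: mem_collapse.
move=> /collapseP[w1 w1y ->] /collapseP[w2 w2x ->]; exact/nextIn_mono/(h _ _ _ _ r).
Qed.

Lemma collapse_fits x y v : v \in F x -> bcol x = bcol y ->
  fits T (g v) y <-> fits F v y.
Proof.
move=> vx exy; split=> -[fl fr]; split=> z w r.
- move=> wz; have c := right_of_col r.
  apply: (collapse_le_reflect vx wz); first by lia.
    by apply/eqP=> e; move: c; rewrite -e; lia.
  by apply: fl r _; apply: mem_collapse.
- move=> wz; have c := right_of_col r.
  apply: (collapse_le_reflect wz vx); first by lia.
    by apply/eqP=> e; move: c; rewrite e; lia.
  by apply: fr r _; apply: mem_collapse.
- by case/collapseP=> w' w'z ->; apply/nextIn_mono/(fl z).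
by case/collapseP=> w' w'z ->; apply/nextIn_mono/(fr z).
Qed.

Lemma collapse_S3 : set_valued F -> S2 F -> S3 T = S3 F.
Proof.
move=> F0 F2; have T0 : set_valued T by rewrite collapse_set_valued.
have T2 : S2 T by rewrite collapse_S2.
apply/(S3P T0 T2)/(S3P F0 F2) => h x y z v w u xyz Ax Ay Az.
  apply: contra (h x y z _ _ _ xyz (collapse_anchor Ax) (collapse_anchor Ay) (collapse_anchor Az)).
  by case/andP=> vu uw; rewrite !nextIn_mono.
have [w' Aw ew] := collapse_anchor_inv F0 Ax.
have [v' Av ev] := collapse_anchor_inv F0 Ay.
have [u' Au eu] := collapse_anchor_inv F0 Az.
apply: contra (h x y z _ _ _ xyz Aw Av Au).
(* In both types the column of the third box lies weakly between those of the other two, so both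
   comparisons can be pulled back. *)
have [r cyz zy zx czx] : [/\ right_of x y, bcol z <= bcol y, y != z, z != x
    & bcol x <= bcol z].
  case/orP: xyz => /and4P[r /eqP c lt _]; have cy := right_of_col r; split=> //.
  - by rewrite c.
  - by apply/eqP=> e; move: lt; rewrite e ltnn.
  - by apply/eqP=> e; move: c cy; rewrite e; lia.
  - by rewrite c cy.
  - by rewrite c cy.
  - by apply/eqP=> e; move: c cy; rewrite e; lia.
  - by apply/eqP=> e; move: lt; rewrite e ltnn.
  by rewrite c.
rewrite ew ev eu => /andP[vu uw].
by rewrite (collapse_le_reflect Av.1 Au.1) // (collapse_le_reflect Au.1 Aw.1).
Qed.

Lemma collapse_S4 : set_valued F -> S2 F -> S4 T = S4 F.
Proof.
move=> F0 F2; have T0 : set_valued T by rewrite collapse_set_valued.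
have T2 : S2 T by rewrite collapse_S2.
apply/(S4P T0 T2)/(S4P F0 F2) => h x y v w u exy xy vx vw Ax Ay vu fit.
  rewrite leqNgt; apply/negP => uw.
  (* Strict inequalities between distinct boxes of one column survive the collapse. *)
  have guw : g u < g w.
    rewrite ltnNge; apply: contraL uw => gwu; rewrite -leqNgt.
    by apply: (collapse_le_reflect Ax.1 Ay.1) gwu; rewrite ?exy.
  have gvu : g v < g u.
    rewrite ltnNge; apply: contraL vu => guv; rewrite -leqNgt.
    by apply: (collapse_le_reflect Ay.1 vx) guv; rewrite ?exy // eq_sym.
  move: (guw); rewrite ltnNge (h x y (g v)) //.
  - exact: mem_collapse.
  - exact: ltn_trans gvu guw.
  - exact: collapse_anchor.
  - exact: collapse_anchor.
  exact/(collapse_fits vx exy).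
have [w' Aw ew] := collapse_anchor_inv F0 Ax.
have [u' Au eu] := collapse_anchor_inv F0 Ay.
case/collapseP: vx => v' v'x ev; rewrite ew eu; apply: nextIn_mono.
have lt_g v1 v2 : g v1 < g v2 -> v1 < v2.
  by rewrite !ltnNge; apply: contra; apply: nextIn_mono.
apply: (h x y v') => //; first by apply: lt_g; rewrite -ev -ew.
  by apply: lt_g; rewrite -ev -eu.
by apply/(collapse_fits v'x exy); rewrite -ev.
Qed.

(** First-column anchors do not move: if [g m > m], a box of [g m] would be strictly left of column
    0, or equal to [x] against the maximality of [m]. *)
Lemma collapse_S5 : set_valued F -> S5 T = S5 F.
Proof.
move=> F0; apply: eq_forallb => x; case: eqP => //= c0.
have [m Am] := anchor_exists x F0; have [mx max_m] := Am.
rewrite (anchorE Am) (anchorE (collapse_anchor Am)); suff -> : g m = m by [].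
have gC : g m \in C by apply/nextIn_present/presentP; exists x.
have /presentP[y gy] := subsetP (mergeable_sub CF) _ gC.
apply/val_inj/eqP; rewrite eqn_leq le_nextIn andbT leqNgt; apply/negP => lt_m.
have := mergeable_left CF mx gy lt_m; rewrite (nextIn_id gC) => /(_ erefl)[|exy].
  by rewrite c0.
by move: lt_m; rewrite ltnNge max_m // exy.
Qed.

Lemma collapse_semistandard : semistandard T = semistandard F.
Proof.
rewrite /semistandard collapse_set_valued collapse_S1 collapse_S2.
case: (boolP (set_valued F)) => //= F0; case: (S1 F) => //=.
by case: (boolP (S2 F)) => //= F2; rewrite collapse_S3 // collapse_S4 // collapse_S5.
Qed.

Lemma present_collapse : present T = C.
Proof.
apply/setP=> u; apply/presentP/idP => [[x /collapseP[v vx ->]] | uC].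
  by apply/nextIn_present/presentP; exists x.
have /presentP[x ux] := subsetP (mergeable_sub CF) u uC.
by exists x; rewrite -(nextIn_id uC) mem_collapse.
Qed.

End Semistandard.

Definition linked F v w : bool :=
  [forall x, forall y, (v \in F x) && (w \in F y) ==> (bcol y < bcol x) || (x == y)].

Lemma linkedP F v w : reflect
  (forall x y, v \in F x -> w \in F y -> right_or_eq x y) (linked F v w).
Proof.
apply: (iffP forallP) => [h x y vx wy | h x].
  have /forallP/(_ y) := h x; rewrite vx wy /= => /orP[|/eqP]; by [left | right].
apply/forallP=> y; apply/implyP=> /andP[vx wy].
by case: (h x y vx wy) => [-> | ->]; rewrite ?eqxx ?orbT.
Qed.

Definition next_present F v w : bool :=
  [&& w \in present F, v < w & [forall u in present F, (v < u) ==> (w <= u)]].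

Definition tops F : {set 'I_n} :=
  [set v in present F | [forall w, next_present F v w ==> ~~ linked F v w]].

Lemma next_presentP F v w : reflect
  [/\ w \in present F, v < w & forall u, u \in present F -> v < u -> w <= u]
  (next_present F v w).
Proof.
apply: (iffP and3P) => -[wF vw h]; split=> //.
  by move=> u uF vu; apply: (implyP (forall_inP h u uF)).
by apply/forall_inP=> u uF; apply/implyP; apply: h.
Qed.

Lemma next_present_exists F v u : u \in present F -> v < u ->
  exists w, next_present F v w.
Proof.
move=> uF vu; pose P w := (w \in present F) && (v < w).
have Pu : P u by rewrite /P uF.
case: (arg_minnP val Pu) => w /andP[wF vw] min_w; exists w.
by apply/next_presentP; split=> // u' u'F vu'; apply: min_w; rewrite /P u'F.
Qed.

Lemma topsPn F v : v \in present F ->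
  reflect (exists2 w, next_present F v w & linked F v w) (v \notin tops F).
Proof.
move=> vF; rewrite in_set vF /=; apply: (iffP forallPn) => [[w] | [w vw l]].
  by rewrite negb_imply negbK => /andP[vw l]; exists w.
by exists w; rewrite negb_imply negbK vw.
Qed.

Lemma tops_sub F : tops F \subset present F.
Proof. by apply/subsetP=> v; rewrite in_set => /andP[]. Qed.

Lemma mergeable_tops F : mergeable (tops F) F.
Proof.
split; first exact: tops_sub.
  move=> v0 v0F; case: (arg_maxnP val v0F) => m mF max_m; exists m; last exact: max_m.
  apply/negPn; apply/topsPn => // -[w /next_presentP[wF mw _] _].
  by move: mw; rewrite ltnNge => /negP[]; apply: max_m.
move=> x y v w vx wy; have [k] := ubnP (w - v).
elim: k x v vx => // k IH x v vx; rewrite ltnS => le_k vw e.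
have vF : v \in present F by apply/presentP; exists x.
have wF : w \in present F by apply/presentP; exists y.
have vN : v \notin tops F.
  apply: contraL vw => vt; rewrite -leqNgt.
  by apply: leq_trans (le_nextIn (tops F) w) _; rewrite -e nextIn_id.
have /(topsPn vF)[w' /next_presentP[w'F vw' min_w'] /linkedP l] := vN.
have w'w : w' <= w by apply: min_w'.
have [ew | ne] := eqVneq w' w; first by apply: l; rewrite ?ew.
have /presentP[y' w'y'] := w'F.
apply: right_or_eq_trans (l _ _ vx w'y') _; apply: (IH y' w') => //; first by lia.
  by rewrite ltn_neqAle w'w andbT.
apply/val_inj/eqP; rewrite eqn_leq nextIn_mono //= -e nextIn_mono // ltnW //.
Qed.

Section TopsMerge.
Variables (C : {set 'I_n}) (F : filling a).
Hypothesis CF : mergeable C F.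
Local Notation g := (nextIn C).
Local Notation T := (collapse C F).

(** An entry [v] outside [C] has a successor not beyond [g v]; both share the chain end [g v], so
    they are linked. *)
Lemma tops_sub_mergeable : tops F \subset C.
Proof.
apply/subsetP=> v vt; have vF := subsetP (tops_sub F) v vt.
apply/negPn/negP=> vC; suff: v \notin tops F by rewrite vt.
apply/topsPn => //.
have gC : g v \in C := nextIn_present CF vF.
have lt_vg : v < g v.
  rewrite ltn_neqAle le_nextIn andbT; apply: contraNneq vC => e.
  by rewrite (_ : v = g v) //; apply: val_inj.
have [w vw] := next_present_exists (subsetP (mergeable_sub CF) _ gC) lt_vg.
exists w => //; have /next_presentP[wF lt_vw min_w] := vw.
apply/linkedP => x y vx wy; apply: (mergeable_left CF vx wy lt_vw).
apply/esym/nextIn_eq => // [|q qC wq]; first by apply: min_w => //; apply: (subsetP (mergeable_sub CF)).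
by have [_ _] := nextInP qC (leq_trans (ltnW lt_vw) wq).
Qed.

Lemma tops_collapse_iff v : v \in C -> (v \in tops T) = (v \in tops F).
Proof.
move=> vC; have vT : v \in present T by rewrite present_collapse.
have vF : v \in present F := subsetP (mergeable_sub CF) v vC.
apply/idP/idP; apply: contraTT => /topsPn h; apply/topsPn => //; case: h => // w.
  move=> /next_presentP[wF vw min_w] /linkedP l.
  have gC : g w \in C := nextIn_present CF wF.
  have lt_vg : v < g w := leq_trans vw (le_nextIn C w).
  exists (g w).
    apply/next_presentP; rewrite present_collapse //; split=> // u uC vu.
    have wu : w <= u by apply: min_w => //; apply: (subsetP (mergeable_sub CF)).
    by have [_ _] := nextInP uC wu.
  apply/linkedP => x y /collapseP[v' v'x ev] /collapseP[w' w'y ew].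
  (* Go from [v'] up to [v] in its chain, along the link to [w], then up to [w']; the outer two
     moves may be trivial. *)
  have /presentP[x0 vx0] := vF; have /presentP[y0 wy0] := wF.
  have xx0 : right_or_eq x x0 \/ v' = v.
    have [-> | ne] := eqVneq v' v; [by right | left].
    apply: (mergeable_left CF v'x vx0); last by rewrite -ev nextIn_id.
    by rewrite ltn_neqAle ne /= ev le_nextIn.
  have lt_vw' : v < w'.
    rewrite ltnNge; apply: contraL lt_vg => w'v; rewrite -leqNgt ew.
    by rewrite -[leqRHS](congr1 val (nextIn_id vC)) nextIn_mono.
  have w'F : w' \in present F by apply/presentP; exists y.
  have y0y : right_or_eq y0 y \/ w = w'.
    have [-> | ne] := eqVneq w w'; [by right | left].
    apply: (mergeable_left CF wy0 w'y) => //.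
    by rewrite ltn_neqAle ne /= min_w.
  case: xx0 y0y => [xx0 | ev'] [y0y | ew'].
  - exact: right_or_eq_trans xx0 (right_or_eq_trans (l _ _ vx0 wy0) y0y).
  - by apply: right_or_eq_trans xx0 (l _ _ vx0 _); rewrite ew'.
  - by apply: right_or_eq_trans (l _ _ _ wy0) y0y; rewrite -ev'.
  by apply: l; rewrite ?ew' -?ev'.
move=> /next_presentP; rewrite present_collapse // => -[wC vw min_w] /linkedP l.
have wF := subsetP (mergeable_sub CF) w wC.
(* Conversely the successor of [v] in [F] collapses to [w], so the link in [T] restricts to one in
   [F]. *)
have [w' vw'] := next_present_exists wF vw; exists w' => //.
have /next_presentP[w'F lt_vw' min_w'] := vw'.
have gw' : g w' = w.
  apply: nextIn_eq => // [|q qC w'q]; first exact: min_w'.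
  exact/min_w/(leq_trans lt_vw').
apply/linkedP => x y vx w'y; apply: l.
  by rewrite -(nextIn_id vC) mem_collapse.
by rewrite -gw' mem_collapse.
Qed.

(** As [present T = C], this says that [T] has no links exactly when [C] consists of the chain ends
    of [F]. *)
Lemma tops_collapse : (tops T == C) = (tops F == C).
Proof.
have sub : tops T \subset C by have := tops_sub T; rewrite (present_collapse CF).
rewrite !eqEsubset tops_sub_mergeable sub /=.
by apply/subsetP/subsetP => h v vC; have := h v vC; rewrite tops_collapse_iff.
Qed.

End TopsMerge.

End Collapse.

(** * Ranks in a finite totally ordered set *)

Section Rank.
Variables (K : finType) (E : {set K}) (lt : rel K).
Hypothesis lt_irr : irreflexive lt.
Hypothesis lt_trans : transitive lt.
Hypothesis lt_total : {in E &, forall p q, p != q -> lt p q || lt q p}.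

Definition rank p : nat := #|[set q in E | lt q p]|.

Lemma rank_lt p q : p \in E -> lt p q -> rank p < rank q.
Proof.
move=> pE pq; apply/proper_card/properP; split.
  by apply/subsetP=> r; rewrite !inE => /andP[-> /lt_trans]; apply.
by exists p; rewrite !inE pE ?pq ?lt_irr.
Qed.

Lemma rank_inj : {in E &, injective rank}.
Proof.
move=> p q pE qE e; apply/eqP; apply/negPn/negP => /(lt_total pE qE)/orP[] h.
  by have := rank_lt pE h; rewrite e ltnn.
by have := rank_lt qE h; rewrite e ltnn.
Qed.

Lemma rank_bound p : p \in E -> rank p < #|E|.
Proof.
move=> pE; apply/proper_card/properP; split; last by exists p; rewrite // inE lt_irr andbF.
by apply/subsetP=> q; rewrite inE => /andP[].
Qed.

Lemma rank_surj r : r < #|E| -> exists2 p, p \in E & rank p = r.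
Proof.
move=> rE; pose f p : 'I_#|E| := insubd (Ordinal rE) (rank p).
have fE p : p \in E -> val (f p) = rank p.
  by move=> pE; rewrite val_insubd rank_bound.
have f_inj : {in E &, injective f}.
  by move=> p q pE qE /(congr1 val); rewrite !fE //; apply: rank_inj.
have /eqP full : f @: E == setT.
  by rewrite eqEcard subsetT cardsT card_ord (card_in_imset f_inj) leqnn.
have : Ordinal rE \in f @: E by rewrite full inE.
by case/imsetP=> p pE e; exists p; rewrite -?fE -?e.
Qed.

(** A down-set is an initial segment: every element of [D] precedes each element of [E] outside
    it. *)
Lemma rank_downset (D : {set K}) p : D \subset E -> p \in E ->
    (forall q r, r \in D -> q \in E -> lt q r -> q \in D) ->
  (rank p < #|D|) = (p \in D).
Proof.
move=> /subsetP DE pE down; apply/idP/idP => [|pD].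
  apply: contraLR => pD; rewrite -leqNgt; apply/subset_leq_card/subsetP => q qD.
  rewrite inE DE //=; have ne : q != p by apply: contraNneq pD => <-.
  case/orP: (lt_total (DE _ qD) pE ne) => // pq.
  by rewrite (down p q) in pD.
apply/proper_card/properP; split; last by exists p; rewrite // inE lt_irr andbF.
by apply/subsetP=> q; rewrite inE => /andP[qE /(down q p pD qE)].
Qed.

Lemma card_rank_lt h : h <= #|E| -> #|[set p in E | rank p < h]| = h.
Proof.
move=> hE; set D := [set p in E | rank p < h].
have DE : D \subset E by apply/subsetP=> p; rewrite inE => /andP[].
have memD p : p \in E -> (p \in D) = (rank p < h) by rewrite inE => ->.
have rankD p : p \in E -> (rank p < #|D|) = (rank p < h).
  move=> pE; rewrite (rank_downset DE pE) ?memD // => q r rD qE qr.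
  move: rD; rewrite !inE qE /= => /andP[_]; apply: ltn_trans.
  exact: rank_lt.
have leD := subset_leq_card DE.
case: (ltngtP #|D| h) => // lt_D.
  have [p pE e] := rank_surj (leq_trans lt_D hE).
  by have := rankD p pE; rewrite e lt_D ltnn.
have [p pE e] := rank_surj (leq_trans lt_D leD).
by have := rankD p pE; rewrite e lt_D ltnn.
Qed.

Lemma card_rank_interval l h : l <= h -> h <= #|E| ->
  #|[set p in E | l <= rank p < h]| = h - l.
Proof.
move=> lh hE; rewrite -{2}(card_rank_lt hE) -{2}(card_rank_lt (leq_trans lh hE)).
rewrite -cardsDS; last first.
  by apply/subsetP=> p; rewrite !inE => /andP[-> /leq_trans]; apply.
congr #|pred_of_set _|; apply/setP=> p; rewrite !inE.
by case: (p \in E) => //=; rewrite -leqNgt.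
Qed.

End Rank.

(** * Splitting a filling, and the mesonic glide of a collapse *)

Section Split.
Variables (n : nat) (a : 'X_{1..n}).
Implicit Types (F T : filling a) (x y z : box a) (u v w : 'I_n) (C : {set 'I_n}).

Definition entries T : {set box a * 'I_n} := [set p | p.2 \in T p.1].

(* Among equal entries, the rightmost comes first. *)
Definition before (p q : box a * 'I_n) : bool :=
  (p.2 < q.2) || ((p.2 == q.2) && (bcol q.1 < bcol p.1)).

Lemma before_irr : irreflexive before.
Proof. by move=> p; rewrite /before !ltnn andbF. Qed.

Lemma before_trans : transitive before.
Proof.
move=> q p r; rewrite /before => /orP[h1 | /andP[/eqP-> h1]] /orP[h2 | /andP[/eqP<- h2]].
- by rewrite (ltn_trans h1).
- by rewrite h1.
- by rewrite h2.
by rewrite eqxx (ltn_trans h2) ?orbT.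
Qed.

Lemma before_total T : S1 T ->
  {in entries T &, forall p q, p != q -> before p q || before q p}.
Proof.
move=> /S1P T1 [x u] [y v]; rewrite !inE /before /= => ux vy ne.
case: (ltngtP u v) => [//|_|/val_inj e]; rewrite ?orbT //; subst v; rewrite eqxx /=; case: (ltngtP (bcol x) (bcol y)) => // exy.
by rewrite (T1 x y u) // eqxx in ne.
Qed.

Lemma card_box_entry T (P : pred 'I_n) :
  \sum_(u | P u) #|[set x | u \in T x]| = #|[set p in entries T | P p.2]|.
Proof.
under eq_bigr do rewrite -sum1dep_card.
rewrite pair_big_dep /= -sum1dep_card (reindex_onto (fun p => (p.2, p.1)) (fun p => (p.2, p.1))) //=.
  by apply: eq_bigl => -[x u]; rewrite inE /= eqxx andbT andbC.
by case.
Qed.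

Definition erank T p : nat := rank (entries T) before p.

(* Listing the entries of [T] in increasing order, [v] replaces those of rank
   [psum b R v] to [psum b R v.+1 - 1]; a red [v] is also added to the box of
   the preceding one. *)
Definition split_filling T b R : filling a :=
  [ffun x => [set v : 'I_n | [exists u, [&& u \in T x,
     psum b R v <= erank T (x, u) + (v \in R) & erank T (x, u) < psum b R v.+1]]]].

(** Each entry of the collapsed filling has exactly one such preimage in its box, so these pairs
    count its entries. *)
Definition chain_min C F x v : bool :=
  (v \in F x) && [forall w in F x, (nextIn C w == nextIn C v) ==> (v <= w)].

Definition reds C F : {set 'I_n} := [set v | [exists x, (v \in F x) && ~~ chain_min C F x v]].

Lemma wtE F v : wt F v = #|[set x | v \in F x]|.
Proof. by rewrite mnmE. Qed.

Lemma supp_wt F : supp (wt F) = present F.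
Proof.
apply/setP=> v; rewrite inE wtE cards_eq0; apply/set0Pn/presentP => -[x].
  by rewrite inE; exists x.
by move=> vx; exists x; rewrite inE.
Qed.

Lemma chain_minP C F x v : reflect
  (v \in F x /\ forall w, w \in F x -> nextIn C w = nextIn C v -> v <= w) (chain_min C F x v).
Proof.
apply: (iffP andP) => -[vx h]; split=> //.
  by move=> w wx e; apply: (implyP (forall_inP h w wx)); rewrite e.
by apply/forall_inP=> w wx; apply/implyP=> /eqP; apply: h.
Qed.

Lemma chain_min_exists C F x v : v \in F x ->
  exists2 w, chain_min C F x w & nextIn C w = nextIn C v.
Proof.
move=> vx; pose P w := (w \in F x) && (nextIn C w == nextIn C v).
have Pv : P v by rewrite /P vx eqxx.
case: (arg_minnP val Pv) => w /andP[wx /eqP e] min_w; exists w => //.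
apply/chain_minP; split=> // w' w'x e'; apply: min_w.
by rewrite /P w'x e' e eqxx.
Qed.

Lemma chain_min_uniq C F x v w : chain_min C F x v -> chain_min C F x w ->
  nextIn C v = nextIn C w -> v = w.
Proof.
case/chain_minP=> vx min_v /chain_minP[wx min_w] e; apply/val_inj/eqP.
by rewrite eqn_leq min_v // min_w.
Qed.

Lemma redsP C F v : reflect
  (exists x w, [/\ v \in F x, w \in F x, w < v & nextIn C w = nextIn C v])
  (v \in reds C F).
Proof.
rewrite inE; apply: (iffP existsP) => [[x /andP[vx]] | [x [w [vx wx wv e]]]].
  have [w rw e] := chain_min_exists C vx => nrv; exists x, w.
  have /chain_minP[wx min_w] := rw; split=> //; rewrite ltn_neqAle min_w // andbT.
  by apply: contraNneq nrv => /val_inj <-.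
exists x; rewrite vx; apply/negP => /chain_minP[_ /(_ w wx e)].
by rewrite leqNgt wv.
Qed.

Section OfMergeable.
Variables (C : {set 'I_n}) (F : filling a).
Hypothesis CF : mergeable C F.
Local Notation g := (nextIn C).
Local Notation T := (collapse C F).
Local Notation R := (reds C F).

(** A red [v] fails to be the chain minimum in only one box: of two such boxes, each would be
    strictly right of the other. *)
Lemma content_chain_min v : content (wt F) R v = #|[set x | chain_min C F x v]|.
Proof.
rewrite /content wtE -(cardsID [set x | chain_min C F x v]).
rewrite (setIidPr _); last by apply/subsetP=> x; rewrite !inE => /andP[].
suff -> : #|[set x | v \in F x] :\: [set x | chain_min C F x v]| = (v \in R) by rewrite addnK.
set N := _ :\: _; case: (boolP (v \in R)) => [/redsP[x [w [vx wx wv e]]] | vR].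
  rewrite (_ : N = [set x]) ?cards1 //; apply/setP=> y; rewrite in_set1.
  have nroot z w' : w' \in F z -> w' < v -> g w' = g v -> ~~ chain_min C F z v.
    by move=> w'z w'v e'; apply/negP=> /chain_minP[_ /(_ w' w'z e')]; rewrite leqNgt w'v.
  apply/idP/eqP => [|->]; last by rewrite !inE vx andbT (nroot _ w).
  rewrite !inE => /andP[nr vy].
  have [w' /chain_minP[w'y min_w'] e'] := chain_min_exists C vy.
  have w'v : w' < v.
    rewrite ltn_neqAle min_w' // andbT; apply: contraNneq nr => /val_inj <-.
    by apply/chain_minP.
  have [h1|//] := mergeable_left CF w'y vx w'v e'.
  by have [|->//] := mergeable_left CF wx vy wv e; rewrite ltnNge ltnW.
apply/eqP; rewrite cards_eq0; apply: contraNT vR => /set0Pn[x].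
by rewrite !inE => /andP[nr vx]; apply/existsP; exists x; rewrite vx.
Qed.

Lemma reds_sub : R \subset supp (wt F).
Proof.
by rewrite supp_wt; apply/subsetP=> v /redsP[x [w [vx _ _ _]]]; apply/presentP; exists x.
Qed.

Lemma supp_wt_collapse : supp (wt T) = C.
Proof. by rewrite supp_wt present_collapse. Qed.

Lemma mes_collapse : mes (wt T) (wt F) R.
Proof.
split.
- exact: reds_sub.
- by rewrite (supp_wt F) supp_wt_collapse; apply: mergeable_next.
- by rewrite (supp_wt F) supp_wt_collapse; apply: mergeable_sub.
- move=> u uC; have eqI : R :&: fiber (wt T) u = [set k in R | k \in fiber (wt T) u].
    by apply/setP=> k; rewrite !inE.
  rewrite -(sum_content _ reds_sub) eqI; congr (_ + _).
  under eq_bigr do rewrite content_chain_min -sum1dep_card.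
  (* Counted box by box: a box of [T] with the entry [u] has one chain minimum over [u], other boxes
     have none. *)
  rewrite (exchange_big_dep xpredT) //= wtE -sum1dep_card [LHS]big_mkcond.
  apply: eq_bigr => x _; case: collapseP => [[v vx eu] | nv].
    have [w rw ew] := chain_min_exists C vx.
    rewrite (big_pred1 w) // => w'; rewrite inE supp_wt_collapse.
    apply/andP/eqP => [[/eqP ew' rw'] | ->]; last by rewrite ew eu.
    by apply: (chain_min_uniq rw' rw); rewrite ew' eu ew.
  rewrite big_pred0 // => v; rewrite inE supp_wt_collapse; apply/andP => -[/eqP ev /andP[vx _]].
  by apply: nv; exists v.
rewrite supp_wt_collapse => v vR; have /redsP[x [w [_ wx wv ew]]] := vR.
(* The least entry of the chain is black, since a red one needs a smaller chain entry in some
   box. *)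
pose P v' := (v' \in present F) && (g v' == g v).
have Pw : P w by rewrite /P ew eqxx andbT; apply/presentP; exists x.
case: (arg_minnP val Pw) => v' /andP[v'F /eqP ev'] min_v'; exists v'; split=> //.
- exact: leq_ltn_trans (min_v' w Pw) wv.
- by rewrite supp_wt.
apply/redsP=> -[y [w' [_ w'y lt_w' ew']]].
suff /min_v' : P w' by rewrite leqNgt lt_w'.
by rewrite /P ew' ev' eqxx andbT; apply/presentP; exists y.
Qed.

End OfMergeable.
End Split.

(** * Collapsing and splitting are mutually inverse *)

Section SplitInverse.
Variables (n : nat) (a : 'X_{1..n}).
Implicit Types (F T : filling a) (x y z : box a) (u v w : 'I_n) (C : {set 'I_n}).

Lemma entriesE T x u : ((x, u) \in entries T) = (u \in T x).
Proof. by rewrite inE. Qed.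

Section OfMergeable.
Variables (C : {set 'I_n}) (F : filling a).
Hypothesis CF : mergeable C F.
Hypothesis F1 : S1 F.
Local Notation g := (nextIn C).
Local Notation T := (collapse C F).
Local Notation R := (reds C F).
Local Notation S := (psum (wt F) R).

Let T_total : {in entries T &, forall p q, p != q -> before p q || before q p}.
Proof. by apply: before_total; rewrite collapse_S1. Qed.

Let D m : {set box a * 'I_n} :=
  [set p in entries T | [exists v : 'I_n, [&& v < m, chain_min C F p.1 v & g v == p.2]]].

Lemma psum_chain_min m : S m = #|D m|.
Proof.
(* Its entries correspond to those of [T] under [g], and its weight is the content. *)
pose F' : filling a := [ffun x => [set v | chain_min C F x v]].
transitivity #|[set p in entries F' | p.2 < m]|.
  rewrite -(card_box_entry F' (fun v => v < m)); apply: eq_bigr => v _; rewrite content_chain_min //.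
  by congr #|pred_of_set _|; apply/setP=> x; rewrite !inE ffunE inE.
pose f (p : box a * 'I_n) := (p.1, g p.2).
rewrite -(card_in_imset (f := f)); last first.
  move=> [x v] [y w]; rewrite !inE !ffunE !inE /= => /andP[rv _] /andP[rw _].
  by case=> exy e; subst y; rewrite (chain_min_uniq rv rw e).
congr #|pred_of_set _|; apply/setP=> -[x u]; apply/imsetP/idP.
  case=> -[y v]; rewrite !inE !ffunE !inE /= => /andP[rv vm] [-> ->].
  have /chain_minP[vy _] := rv; rewrite imset_f //=.
  by apply/existsP; exists v; rewrite vm rv eqxx.
rewrite inE => /andP[_ /existsP[v /and3P[vm rv /eqP e]]]; exists (x, v).
  by rewrite !inE ffunE inE rv.
by rewrite /f /= e.
Qed.

(** Along [before] the chain minima increase weakly, so [D m] is a down-set and [rank_downset]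
    applies. *)
Lemma rank_chain_min x v m : chain_min C F x v -> (erank T (x, g v) < S m) = (v < m).
Proof.
move=> rv; have /chain_minP[vx _] := rv.
have memE y w : chain_min C F y w -> (y, g w) \in entries T.
  by case/chain_minP=> wy _; rewrite entriesE mem_collapse.
rewrite psum_chain_min (rank_downset (@before_irr n a) T_total); first 1 last.
- by apply/subsetP=> p; rewrite inE => /andP[].
- exact: memE.
- move=> [y u'] [z u]; rewrite !inE /=.
  case/andP=> uz /existsP[v1 /and3P[v1m rv1 /eqP ev1]] u'y lt.
  rewrite u'y /=; apply/existsP; have /collapseP[w0 w0y eu'] := u'y.
  have [w rw ew] := chain_min_exists C w0y; exists w.
  rewrite rw ew eu' eqxx /= andbT; apply: leq_ltn_trans v1m.
  have /chain_minP[wy _] := rw; have /chain_minP[v1z _] := rv1.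
  case/orP: lt => /= [lt | /andP[/eqP e lt]].
    rewrite leqNgt; apply/negP => v1w; move: lt.
    by rewrite eu' -ew -ev1 ltnNge nextIn_mono // ltnW.
  apply: (collapse_le_reflect CF wy v1z (ltnW lt)).
    by apply/eqP=> eyz; move: lt; rewrite eyz ltnn.
  by rewrite ew -eu' e ev1.
rewrite inE memE //=; apply/existsP/idP => [[w /and3P[wm rw /eqP e]] | vm].
  by rewrite (chain_min_uniq rv rw).
by exists v; rewrite vm rv eqxx.
Qed.

(** No chain minimum below [v] belongs to an entry after [(x, g v)]: in the same chain it would sit
    strictly right of [x], or in [x]. *)
Lemma psum_le_rank x v w : v \in F x -> w \in F x -> w < v -> g w = g v ->
  S v <= (erank T (x, g v)).+1.
Proof.
move=> vx wx wv e; rewrite psum_chain_min.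
apply: (@leq_trans #|(x, g v) |: [set q in entries T | before q (x, g v)]|); last first.
  by rewrite cardsU1 -add1n leq_add2r leq_b1.
apply/subset_leq_card/subsetP => -[y u]; rewrite inE => /andP[qE].
case/existsP=> w' /and3P[w'v /= rw' /eqP ew']; rewrite in_setU1 in_set qE /=.
have [//|ne] := eqVneq (y, u) (x, g v).
have pE : (x, g v) \in entries T by rewrite entriesE mem_collapse.
have /orP[//|] := T_total qE pE ne.
have /chain_minP[w'y _] := rw'.
have le_u : u <= g v by rewrite -ew' nextIn_mono // ltnW.
case/orP=> [|/andP[/eqP/= e' lt]] /=; first by rewrite ltnNge le_u.
have [|eyx] := mergeable_left CF w'y vx w'v (etrans ew' (esym e')).
  by move=> lt'; have := ltn_trans lt lt'; rewrite ltnn.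
by move: ne; rewrite eyx e' eqxx.
Qed.

Lemma split_collapse : split_filling T (wt F) R = F.
Proof.
apply/ffunP=> x; apply/setP=> v; rewrite ffunE in_set; apply/existsP/idP.
  case=> u /and3P[/collapseP[w wx eu]].
  have [v0 rv0 ev0] := chain_min_exists C wx.
  rewrite eu -ev0 (rank_chain_min _ rv0) ltnS => le_v; rewrite leq_eqVlt => /predU1P[e|lt_v].
    by have /chain_minP[vx _] := rv0; rewrite -(ord_inj e).
  (* Now [v] is red and the rank is [S v - 1]. The box [x0] where [v] is not the chain minimum gives
     the same rank, so [x0 = x]. *)
  have lt_rank : erank T (x, g v0) < S v by rewrite (rank_chain_min _ rv0).
  have vR : v \in R by case: (v \in R) le_v => //; rewrite addn0 leqNgt lt_rank.
  have /redsP[x0 [w0 [vx0 w0x0 w0v ew0]]] := vR.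
  have [v1 rv1 ev1] := chain_min_exists C vx0.
  have v1v : v1 < v.
    have /chain_minP[_ min_v1] := rv1; apply: leq_ltn_trans w0v; apply: min_v1 => //.
    by rewrite ev1.
  have lt_rank1 : erank T (x0, g v) < S v by rewrite -ev1 (rank_chain_min _ rv1).
  have le1 := psum_le_rank vx0 w0x0 w0v ew0.
  have er : erank T (x0, g v) = erank T (x, g v0).
    rewrite vR addn1 in le_v; apply/eqP; rewrite eqn_leq -ltnS (leq_trans lt_rank1) //.
    by rewrite -ltnS (leq_trans lt_rank).
  have : (x0, g v) = (x, g v0).
    apply: (rank_inj (@before_irr n a) (@before_trans n a) T_total) er; rewrite entriesE.
      exact: mem_collapse.
    by rewrite ev0; apply: mem_collapse.
  by case=> <-.
move=> vx; have [v0 rv0 ev0] := chain_min_exists C vx; exists (g v).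
rewrite mem_collapse //= -{2}ev0 (rank_chain_min _ rv0) ltnS.
have /chain_minP[v0x min_v0] := rv0; rewrite min_v0 // andbT.
have [e | ne] := eqVneq v0 v.
  by apply: leq_trans (leq_addr _ _); rewrite leqNgt -e (rank_chain_min _ rv0) ltnn.
have lt_v : v0 < v by rewrite ltn_neqAle ne min_v0.
have -> : v \in R by apply/redsP; exists x, v0.
by rewrite addn1; apply: psum_le_rank vx v0x lt_v ev0.
Qed.

End OfMergeable.

Section OfMesonic.
Variables (T : filling a) (b : 'X_{1..n}) (R : {set 'I_n}).
Hypothesis T1 : S1 T.
Hypothesis M : mes (wt T) b R.
Local Notation C := (present T).
Local Notation g := (nextIn C).
Local Notation S := (psum b R).
Local Notation F := (split_filling T b R).

Let T_total := before_total T1.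

Let in_split x v u : bool :=
  [&& u \in T x, S v <= erank T (x, u) + (v \in R) & erank T (x, u) < S v.+1].

Let mem_split x v : reflect (exists u, in_split x v u) (v \in F x).
Proof. by rewrite ffunE in_set; apply: existsP. Qed.

Lemma psum_present u : u \in C -> S u.+1 = #|[set p in entries T | p.2 <= u]|.
Proof.
rewrite -supp_wt => uC; rewrite (mes_psum M uC) -(card_box_entry T (fun k => k <= u)).
by apply: eq_bigr => k _; rewrite wtE.
Qed.

Lemma psum_total : S n = #|entries T|.
Proof.
rewrite /psum (eq_bigl xpredT) => [|k]; last exact: ltn_ord.
rewrite (mes_content (P := xpredT) M) //; under eq_bigr do rewrite wtE.
by rewrite card_box_entry; congr #|pred_of_set _|; apply/setP=> p; rewrite inE andbT.
Qed.

(** Guarantees that a red [v] has a preceding rank, inside its own block, whose box it can join. *)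
Lemma psum_black v : v \in R -> exists2 w : 'I_n, w < v /\ g w = g v & S w < S v.
Proof.
case/(mes_black M) => w [wv wb wR]; rewrite supp_wt => e; exists w => //.
apply: leq_trans (leq_psum b R wv); rewrite psumS /content (negbTE wR) subn0.
by rewrite -addn1 leq_add2l lt0n; rewrite inE in wb.
Qed.

Lemma in_split_next x v u : in_split x v u -> g v = u.
Proof.
case/and3P=> ux le_v lt_v; have uC : u \in C by apply/presentP; exists x.
have pE : (x, u) \in entries T by rewrite entriesE.
have lt_u : erank T (x, u) < S u.+1.
  rewrite psum_present // (rank_downset (@before_irr n a) T_total) //=.
  - by rewrite inE pE /=.
  - by apply/subsetP=> p; rewrite inE => /andP[].
  move=> q r; rewrite !inE => /andP[_ ru] -> /=.
  by case/orP=> [/ltnW/leq_trans | /andP[/eqP->]] //; apply.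
apply: nextIn_eq => // [|q qC vq].
  (* If [u < v], then [v] is red and borrows the rank [S v - 1]; but the black entry of its block
     comes after [u] and raises the partial sum beyond that rank. *)
  rewrite leqNgt; apply/negP => uv; have le1 := leq_psum b R uv.
  have vR : v \in R by move: le_v; case: (v \in R); lia.
  have [w [wv ew] lt_w] := psum_black vR.
  have uw : u < w.
    rewrite ltnNge; apply/negP => wu; have [_ _] := nextInP uC wu.
    by rewrite ew leqNgt (leq_trans uv) // le_nextIn.
  have := leq_psum b R uw; move: le_v; rewrite vR; lia.
rewrite leqNgt; apply/negP => qu; move: lt_v; rewrite ltnNge => /negP[].
have vq' : v.+1 <= q.+1 by [].
apply: leq_trans (leq_psum b R vq') _; rewrite psum_present //.
apply/subset_leq_card/subsetP => p; rewrite !inE => /andP[-> /= pq].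
by rewrite /before (leq_ltn_trans pq).
Qed.

(** Smaller replacements take smaller ranks, and equal entries are ranked from right to left. *)
Lemma in_split_le x y v w u : in_split x v u -> in_split y w u -> v < w ->
  right_or_eq x y.
Proof.
case/and3P=> ux _ lt_v /and3P[uy le_w _] vw.
have le_rank : erank T (x, u) <= erank T (y, u).
  have := leq_psum b R vw; have := leq_b1 (w \in R); lia.
have [-> | ne] := eqVneq x y; [by right | left].
have ne' : (x, u) != (y, u) by apply: contra ne => /eqP[->].
have xE : (x, u) \in entries T by rewrite entriesE.
have yE : (y, u) \in entries T by rewrite entriesE.
have /orP[] := T_total xE yE ne'.
  by rewrite /before ltnn eqxx.
move/(rank_lt (@before_irr n a) (@before_trans n a) yE).
by rewrite ltnNge -/(erank T (x, u)) le_rank.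
Qed.

(** The least [m] with rank below [S m] is positive, as [S 0 = 0], and [m.-1] satisfies the lower
    bound without the red shift. *)
Lemma in_split_chain_min x u : u \in T x ->
  exists2 v, in_split x v u & S v <= erank T (x, u).
Proof.
move=> ux; have pE : (x, u) \in entries T by rewrite entriesE.
pose P m := erank T (x, u) < S m.
have Pn : P n by rewrite /P psum_total; apply: rank_bound pE; apply: before_irr.
have exP : exists m, P m by exists n.
case: (ex_minnP exP) => m Pm min_m.
have m_gt0 : 0 < m.
  by rewrite lt0n; apply/eqP=> m0; move: Pm; rewrite /P m0 /psum big_pred0.
have mn : m.-1 < n.
  by rewrite prednK // min_m.
exists (Ordinal mn).
  rewrite /in_split ux /= prednK // andbC; apply/andP; split; first exact: Pm.
  apply: leq_trans (leq_addr _ _); rewrite leqNgt; apply/negP => /min_m; lia.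
by rewrite leqNgt; apply/negP => /min_m /=; lia.
Qed.

(** The ranks open to [v] form an interval of length [b v], and they lie in distinct boxes because
    the replaced entry must be [g v]. *)
Lemma wt_split : wt F = b.
Proof.
apply/mnmP=> v; rewrite wtE.
transitivity #|[set p in entries T | S v - (v \in R) <= erank T p < S v.+1]|.
  rewrite -[RHS](card_in_imset (f := fst)).
    congr #|pred_of_set _|; apply/setP=> x; rewrite in_set.
    apply/mem_split/imsetP => [[u /and3P[ux le_v lt_v]] | [[y u]]].
      by exists (x, u); rewrite // !inE /= ux lt_v leq_subLR addnC le_v.
    rewrite !inE /= leq_subLR addnC => /and3P[uy le_v lt_v] ->.
    by exists u; apply/and3P.
  move=> [x u] [y u']; rewrite !inE /= ![_ - _ <= _]leq_subLR ![(v \in R) + _]addnC.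
  move=> /(@in_split_next x v u) <- /(@in_split_next y v u') <- /= exy.
  by rewrite exy.
rewrite card_rank_interval ?psumS /content; first 1 last.
- exact: (@before_irr n a).
- exact: (@before_trans n a).
- exact: T_total.
- by rewrite leq_subLR addnC -addnA leq_addr.
- by rewrite -/(content b R v) -psumS -psum_total leq_psum.
have := contentK v (mes_red M); rewrite /content.
case: (boolP (v \in R)) => [/psum_black[w _]|_]; lia.
Qed.

Lemma mergeable_split : mergeable C F.
Proof.
split.
- by rewrite -!supp_wt wt_split; apply: (mes_supp M).
- by rewrite -!supp_wt wt_split; apply: (mes_last M).
move=> x y v w /mem_split[u h] /mem_split[u' h'] vw e.
have eu : u' = u by rewrite -(in_split_next h) -(in_split_next h').
by apply: in_split_le h _ vw; rewrite -eu.
Qed.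

Lemma collapse_split : collapse C F = T.
Proof.
apply/ffunP=> x; apply/setP=> u; apply/collapseP/idP => [[v /mem_split[u' h] ->] | ux].
  by rewrite (in_split_next h); case/and3P: h.
have [v h _] := in_split_chain_min ux; exists v; first by apply/mem_split; exists u.
by rewrite (in_split_next h).
Qed.

Lemma reds_split : reds C F = R.
Proof.
apply/setP=> v; apply/redsP/idP => [[x [w [/mem_split[u h] /mem_split[u' h'] wv e]]] | vR].
  have eu : u' = u by rewrite -(in_split_next h) -(in_split_next h').
  rewrite eu in h'; case/and3P: h h' => _ le_v _ /and3P[_ _ lt_w].
  have := leq_psum b R wv; case: (v \in R) le_v => //; lia.
have [w0 _ lt_w0] := psum_black vR.
(* The entry of this rank is in the box that the red [v] joins. *)
have lt_E : (S v).-1 < #|entries T|.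
  by have := leq_psum b R (ltnW (ltn_ord v)); rewrite psum_total; lia.
have [[x u] pE er] := rank_surj (@before_irr n a) (@before_trans n a) T_total lt_E.
have ux : u \in T x by rewrite -entriesE.
have hv : in_split x v u.
  rewrite /in_split ux vR /erank er; have := leq_psum b R (leqnSn v); lia.
have [w hw le_w] := in_split_chain_min ux; exists x, w; split.
- by apply/mem_split; exists u.
- by apply/mem_split; exists u.
- rewrite ltnNge; apply/negP => /(leq_psum b R); move: le_w; rewrite /erank er; lia.
by rewrite (in_split_next hw) (in_split_next hv).
Qed.

End OfMesonic.
End SplitInverse.

(** * Fibres of the collapse and the expansion of Lascoux atoms *)

Section Atoms.
Variables (n : nat) (a : 'X_{1..n}).
Implicit Types (F T : filling a) (m : 'X_{1..n}) (R : {set 'I_n}).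

(** One entry per box is an anchor, so powers of beta can be compared through degrees. *)
Lemma excess_card F : set_valued F -> excess F + #|{: box a}| = mdeg (wt F).
Proof.
move=> F0; rewrite mdegE; under eq_bigr do rewrite wtE.
rewrite (card_box_entry F xpredT) (_ : finset _ = entries F); last first.
  by apply/setP=> p; rewrite inE andbT.
rewrite -(cardsID [set p : box a * 'I_n | anchor F p.1 == p.2]) addnC; congr (_ + _).
  have /fin_all_exists[s sP] x := anchor_exists x F0.
  rewrite -(card_imset (f := fun x => (x, s x))); last by move=> x y [].
  congr #|pred_of_set _|; apply/setP=> -[x v]; rewrite !inE /=; apply/imsetP/andP.
    by case=> y _ [-> ->]; rewrite (anchorE (sP y)) eqxx; have [] := sP y.
  case=> vx /eqP e; exists x => //; congr (_, _); apply: ord_inj.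
  by rewrite -(anchorE (sP x)).
congr #|pred_of_set _|; apply/setP=> p; rewrite !inE andbC /Defs.free.
by rewrite [in RHS]andbC [in RHS]eq_sym andbC.
Qed.

Definition top_collapse F : filling a := collapse (tops F) F.

Lemma semistandard_S1 F : semistandard F -> S1 F.
Proof. by case/and3P. Qed.

Lemma semistandard_set_valued F : semistandard F -> set_valued F.
Proof. by case/and3P. Qed.

Lemma top_collapse_semistandard F : semistandard (top_collapse F) = semistandard F.
Proof. exact: collapse_semistandard (mergeable_tops F). Qed.

Lemma tops_top_collapse F : tops (top_collapse F) == present (top_collapse F).
Proof.
by rewrite (present_collapse (mergeable_tops F)) (tops_collapse (mergeable_tops F)).
Qed.

Lemma mes_top_collapse F : mes (wt (top_collapse F)) (wt F) (reds (tops F) F).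
Proof. exact: mes_collapse (mergeable_tops F). Qed.

Lemma excess_top_collapse F : semistandard F ->
  excess F = excess (top_collapse F) + #|reds (tops F) F|.
Proof.
move=> Fss; have := mes_mdeg (mes_top_collapse F).
rewrite -!excess_card; first by lia.
  by apply: semistandard_set_valued; rewrite top_collapse_semistandard.
exact: semistandard_set_valued.
Qed.

Lemma tops_split T m R : S1 T -> tops T == present T -> mes (wt T) m R ->
  tops (split_filling T m R) = present T.
Proof.
move=> T1 topT M; apply/eqP; rewrite -(tops_collapse (mergeable_split T1 M)).
by rewrite collapse_split.
Qed.

Lemma top_collapse_split T m R : S1 T -> tops T == present T -> mes (wt T) m R ->
  top_collapse (split_filling T m R) = T.
Proof. by move=> T1 topT M; rewrite /top_collapse tops_split // collapse_split. Qed.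

Local Open Scope ring_scope.

(** [F] corresponds to the colouring [reds (tops F) F], with inverse [split_filling T m]; the excess
    grows by the number of red entries. *)
Lemma sum_split_fiber T m : semistandard T -> tops T == present T ->
  \sum_(F : filling a | (semistandard F && (top_collapse F == T)) && (wt F == m))
     'X^(excess F) =
  'X^(excess T) * (kaon (wt T))@_m :> {poly int}.
Proof.
move=> Tss topT; have T1 := semistandard_S1 Tss.
rewrite mcoeff_kaon mulr_sumr.
rewrite [RHS](reindex_onto (fun F => reds (tops F) F) (split_filling T m)) /=; last first.
  by move=> R /mesonicP M; rewrite tops_split // reds_split.
apply/esym/eq_big => [F | F /andP[/mesonicP M /eqP eF]].
  apply/andP/andP => [[/mesonicP M /eqP eF] | [/andP[Fss /eqP <-] /eqP <-]].
    have eT : top_collapse F = T by rewrite -eF top_collapse_split.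
    by rewrite -top_collapse_semistandard eT Tss eqxx -eF (wt_split T1 M).
  split; first exact/mesonicP/mes_top_collapse.
  by apply/eqP/split_collapse; [exact: mergeable_tops | exact: semistandard_S1].
have eT : top_collapse F = T by rewrite -eF top_collapse_split.
have Fss : semistandard F by rewrite -top_collapse_semistandard eT.
by rewrite -exprD (excess_top_collapse Fss) eT.
Qed.

Lemma lascoux_sum_kaons :
  lascoux_atom a =
  \sum_(T : filling a | semistandard T && (tops T == present T))
     'X^(excess T) *: kaon (wt T).
Proof.
apply/mpolyP=> m; rewrite /lascoux_atom !raddf_sum /=.
rewrite (partition_big top_collapse
  (fun T => semistandard T && (tops T == present T))) /=; last first.
  by move=> F Fss; rewrite top_collapse_semistandard Fss tops_top_collapse.
apply: eq_bigr => T /andP[Tss topT]; rewrite mcoeffZ -sum_split_fiber //.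
rewrite [RHS]big_mkcondr; apply: eq_bigr => F _.
by rewrite mcoeffZ mcoeffX; case: eqP; rewrite ?mulr1 ?mulr0.
Qed.

Lemma lascoux_kaon_positive : kaon_positive (lascoux_atom a).
Proof. rewrite lascoux_sum_kaons; exact: kaon_positive_sum. Qed.

End Atoms.

Local Open Scope ring_scope.

Theorem theorem1p2 (n : nat) (hn : (1 <= n)%N) :
  [/\ is_basis (@kaon n),
      forall a : 'X_{1..n},
        map_mpoly (horner_eval (0 : int)) (kaon a) = fundamental_particle a,
      forall a : 'X_{1..n}, kaon_positive (glide_poly a)
    & forall a : 'X_{1..n}, kaon_positive (lascoux_atom a)].
Proof.
split.
- exact: kaon_basis.
- exact: kaon_at0.
- exact: glide_kaon_positive.
- exact: lascoux_kaon_positive.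
Qed.
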